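(* Let $0<\eta<1$ and let $\boldsymbol{X}_1,\dots,\boldsymbol{X}_n$ be independent $\mathbb{R}^d$-valued $\eta$-HC random vectors with $\mathbb{E}[\boldsymbol{X}_j]=0$ for all $j$. Let $M_j=\mathrm{Cov}[\boldsymbol{X}_j]$, $\boldsymbol{S}=\boldsymbol{X}_1+\dots+\boldsymbol{X}_n$, $M=\mathrm{Cov}[\boldsymbol{S}]=M_1+\dots+M_n$, and assume $M[i,i]=1$ for all $i\in[d]$. Let $\sigma_j^2=\mathbb{E}[\|\boldsymbol{X}_j\|^2]$ (Euclidean norm). Let $\boldsymbol{G}_1,\dots,\boldsymbol{G}_n$ be independent centered $d$-dimensional Gaussian vectors with $\mathrm{Cov}[\boldsymbol{G}_j]=M_j$ and $\boldsymbol{G}=\boldsymbol{G}_1+\dots+\boldsymbol{G}_n$. Let $A\subseteq\mathbb{R}^d$ be a translate of a union of orthants. Then $$|\Pr[\boldsymbol{S}\in A]-\Pr[\boldsymbol{G}\in A]|\le O(\eta^{-1/2}d^{13/8})\cdot\Big(\sum_{j=1}^n\sigma_j^4\Big)^{1/8}.$$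
   Context: For an $\mathbb{R}^d$-valued random vector, $\|\boldsymbol{X}\|_p=\mathbb{E}[\|\boldsymbol{X}\|^p]^{1/p}$ with $\|\cdot\|$ the Euclidean length. $\boldsymbol{X}$ is $\eta$-HC ($0<\eta<1$) if $\|\boldsymbol{X}\|_4<\infty$ and for all $A\in\mathbb{R}^d$, $\|A+\eta\boldsymbol{X}\|_4\le\|A+\boldsymbol{X}\|_2$. For $x\in\mathbb{R}$, $\mathrm{sgn}(x)=1$ if $x\ge0$ and $-1$ otherwise; for $X\in\mathbb{R}^d$, $\overrightarrow{\mathrm{sgn}}(X)\in\{-1,1\}^d$ is coordinatewise sign. $A\subseteq\mathbb{R}^d$ is a translate of a union of orthants if there is $\Theta\in\mathbb{R}^d$ such that whether $X\in A$ depends only on $\overrightarrow{\mathrm{sgn}}(X-\Theta)$. *)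

(* Defs.v *)
From HB Require Import structures.
From mathcomp Require Import all_boot all_order all_algebra.
From mathcomp Require Import all_classical all_reals all_analysis.

Set Implicit Arguments.
Unset Strict Implicit.
Unset Printing Implicit Defensive.

Import Order.TTheory GRing.Theory Num.Theory.
Import numFieldNormedType.Exports.

Local Open Scope classical_set_scope.
Local Open Scope ring_scope.

(* The Borel sigma-algebra of a matrix space (in particular of R^d, represented
   by row vectors), so that random vectors are {RV P >-> 'rV[R]_d}. *)
Definition mx_borel_display : measure_display. Proof. exact. Qed.

Section matrix_borel.
Context (R : realType) (m n : nat).

Definition mx_borel : set (set 'M[R]_(m, n)) := <<s [set U | open U] >>.

Let mx_borel0 : mx_borel set0. Proof. exact: sigma_algebra0. Qed.

Let mx_borelC B : mx_borel B -> mx_borel (~` B).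
Proof. exact: sigma_algebraC. Qed.

Let mx_borel_bigcup (F : (set 'M[R]_(m, n))^nat) :
  (forall i, mx_borel (F i)) -> mx_borel (\bigcup_i F i).
Proof. exact: sigma_algebra_bigcup. Qed.

HB.instance Definition _ := @isMeasurable.Build mx_borel_display
  'M[R]_(m, n) mx_borel mx_borel0 mx_borelC mx_borel_bigcup.

End matrix_borel.

Section vectors.
Context (R : realType) (d : nat).
Implicit Types (x y : 'rV[R]_d) (A : set 'rV[R]_d).

Definition inner x y : R := \sum_(i < d) x 0 i * y 0 i.

(* The norm `|x| that the library puts on 'rV[R]_d is the sup norm. *)
Definition eucl_norm x : R := Num.sqrt (\sum_(i < d) x 0 i ^+ 2).

(* Num.sg is not usable here: it vanishes at 0. *)
Definition sgn (r : R) : R := if 0 <= r then 1 else -1.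

Definition vsgn x : 'rV[R]_d := map_mx sgn x.

Definition translate_of_union_of_orthants A : Prop :=
  exists theta : 'rV[R]_d, forall x y,
    vsgn (x - theta) = vsgn (y - theta) -> (A x <-> A y).

End vectors.

Section random_vectors.
Context (R : realType) (dT : measure_display) (T : measurableType dT).
Variable P : probability T R.

Definition vec_Lnorm (p : R) (d : nat) (X : T -> 'rV[R]_d) : \bar R :=
  Lnorm P p%:E (fun w => (eucl_norm (X w))%:E).

Definition HC (eta : R) (d : nat) (X : T -> 'rV[R]_d) : Prop :=
  (vec_Lnorm 4 X < +oo)%E /\
  forall a : 'rV[R]_d,
    (vec_Lnorm 4 (fun w => a + eta *: X w)%R
       <= vec_Lnorm 2 (fun w => a + X w)%R)%E.

Definition centered (d : nat) (X : T -> 'rV[R]_d) : Prop :=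
  forall i : 'I_d, ('E_P[fun w => (X w 0 i)%R] = 0)%E.

Definition covmx (d : nat) (X : T -> 'rV[R]_d) : 'M[R]_d :=
  \matrix_(i < d, j < d)
    fine (covariance P (fun w => X w 0 i) (fun w => X w 0 j)).

Definition mutually_independent (n d : nat)
    (X : 'I_n -> T -> 'rV[R]_d) : Prop :=
  forall (J : {set 'I_n}) (B : 'I_n -> set 'rV[R]_d),
    (forall j, measurable (B j)) ->
    P (\bigcap_(j in [set` J]) (X j @^-1` B j))
      = (\prod_(j in J) P (X j @^-1` B j))%E.

(* normal_prob m 0 is by convention the uniform law on [0, 1]; the normal law
   of variance 0 is the point mass at m. *)
Definition normal_law (m s : R) (B : set R) : \bar R :=
  if s == 0 then (\d_m B)%E else normal_prob m s B.

(* Defined through linear forms, so that singular covariances are allowed. *)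
Definition gaussian_vector (d : nat) (X : T -> 'rV[R]_d) : Prop :=
  forall a : 'rV[R]_d, exists m s : R, forall B : set R, measurable B ->
    P ((fun w => inner a (X w)) @^-1` B) = normal_law m s B.

End random_vectors.

(* Main.v *)
Require Import Defs.
From HB Require Import structures.
From mathcomp Require Import all_boot all_order all_algebra.
From mathcomp Require Import all_classical all_reals all_analysis.
From mathcomp Require Import measurable_realfun.
From mathcomp Require Import ring lra.

Set Implicit Arguments.
Unset Strict Implicit.
Unset Printing Implicit Defensive.

Import Order.TTheory GRing.Theory Num.Theory.
Import numFieldNormedType.Exports.

Local Open Scope classical_set_scope.
Local Open Scope ring_scope.

(** Lindeberg's replacement method.  The indicator of [A] is smoothed one
    coordinate at a time: along coordinate [i] it becomes
    [phi (x_i) f + (1 - phi (x_i)) g], with [phi] a cubic spline rising from 0 to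
    1 on a window of width of order [lambda] around [theta_i].  Such convex
    mixtures keep a third-order Taylor remainder bounded by
    [(3 / lambda * sum_i |y_i|) ^ 3], with no dimensional loss.  The first two
    moments match, so replacing the [X_j] by the [G_j] one by one costs at most
    the sum of the third absolute moments over [lambda ^ 3].  The smoothing error
    is at most the sum over [i] of plateau functions equal to 1 near [theta_i];
    each of them is itself smooth, hence comparable for the two sums, and it has
    expectation [O (lambda)] under the Gaussian sum, whose coordinates have
    variance 1.  Hypercontractivity bounds fourth moments by [eta ^ -4 sigma ^ 4],
    AM-GM passes to third moments, and [lambda = t sqrt d], with
    [t = eta ^ (- 1 / 2) (sum_j sigma_j ^ 4) ^ (1 / 8)], gives
    [O (d ^ (3 / 2) t)]. *)

(** * Independence *)

(** The scale balances two costs. There are [d] windows, so smoothing costs a multiple of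
    [d lambda]; replacement costs a multiple of [d ^ 3 t ^ 4 / lambda ^ 3]. The two agree at
    [lambda = t sqrt d]. The factor [d ^ 3] arises in the fourth-moment half of AM-GM: [d ^ 2] from
    bounding the l1 norm by the Euclidean one, and one more [d] from the fourth-moment constant of a
    Gaussian vector with arbitrary covariance.

    What shapes the Gaussian side is that only the laws of linear forms of each single [G_j] are
    given, possibly degenerate. Neither the law of their sum nor any exact moment is computed:
    moments are read off exponential integrals, and anticoncentration comes from integrating out one
    summand at a time. The price is factors such as [exp (1 / 2)] in the absolute constant.

    The three Taylor orders are tracked together because mixing two functions multiplies a remainder
    of one order by a term of another; a class defined by the third order alone would not be closed
    under mixing. *)

Definition independent_pair (R : realType) d (T : measurableType d)
    (P : probability T R) (U V : T -> R) : Prop :=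
  forall A B : set R, measurable A -> measurable B ->
    (P ((U @^-1` A) `&` (V @^-1` B)) = P (U @^-1` A) * P (V @^-1` B))%E.

Section independent_pairs.
Context (R : realType) d (T : measurableType d) (P : probability T R).
Variables U V : T -> R.
Hypotheses (mU : measurable_fun [set: T] U) (mV : measurable_fun [set: T] V).
Hypothesis UV : independent_pair P U V.

Let mUV : measurable_fun [set: T] (fun w => (U w, V w)).
Proof. exact: measurable_fun_pair. Qed.

Let UM : {mfun T >-> R} := mfun_Sub (mem_set mU : U \in mfun).
Let VM : {mfun T >-> R} := mfun_Sub (mem_set mV : V \in mfun).
Let UVM : {mfun T >-> (R * R)%type} :=
  mfun_Sub (mem_set mUV : (fun w => (U w, V w)) \in mfun).

Let jointE (X : set (R * R)) : measurable X ->
  (distribution P UM \x distribution P VM)%E X = distribution P UVM X.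
Proof.
apply: product_measure_unique => A B mA mB.
exact: UV.
Qed.

(** Tonelli for the joint law, which [jointE] identifies with the product of the marginals from
    their agreement on rectangles. It allows one variable to be integrated out with the other
    frozen. *)
Lemma independent_pair_ge0_integral (F : (R * R)%type -> \bar R) :
  measurable_fun setT F -> (forall z, 0 <= F z)%E ->
  (\int[P]_w F (U w, V w) = \int[P]_v \int[P]_w F (U w, V v))%E.
Proof.
move=> mF F0.
transitivity (\int[distribution P UVM]_z F z)%E.
  by rewrite ge0_integral_distribution.
transitivity (\int[distribution P UM \x distribution P VM]_z F z)%E.
  apply: eq_measure_integral => X mX _; first [exact: jointE | exact/esym/jointE].
rewrite fubini_tonelli2 // ge0_integral_distribution.
- apply: eq_integral => v _ /=.
  rewrite /fubini_G ge0_integral_distribution //.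
  by apply: measurableT_comp => //; exact: measurable_pair2.
- exact: measurable_fun_fubini_tonelli_G.
- by move=> y; apply: integral_ge0.
Qed.

(** First moments suffice: by Tonelli the integral of [|U V|] factors, so no second moments have to
    be supplied for Cauchy-Schwarz. *)
Lemma independent_pair_integrableM :
  P.-integrable setT (EFin \o U) -> P.-integrable setT (EFin \o V) ->
  P.-integrable setT (EFin \o (fun w => U w * V w)).
Proof.
move=> iU iV; apply/integrableP; split.
  by apply/measurable_EFinP; exact: measurable_funM.
pose F (z : R * R) : \bar R := (`|z.1 * z.2|)%:E.
have mF : measurable_fun setT F.
  apply/measurable_EFinP/measurableT_comp => //.
  exact: measurable_funM.
rewrite -[ltLHS]/(\int[P]_w F (U w, V w))%E independent_pair_ge0_integral //; last first.
  by move=> z; rewrite lee_fin.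
rewrite /F /=.
under eq_integral do under eq_integral do rewrite normrM mulrC EFinM.
have fU : (\int[P]_w (`|U w|)%:E < +oo)%E by case/integrableP: iU.
have fV : (\int[P]_w (`|V w|)%:E < +oo)%E by case/integrableP: iV.
under eq_integral => v _.
  rewrite ge0_integralZl//=; last by apply/measurable_EFinP/measurableT_comp.
  over.
rewrite /= ge0_integralZr//=; last 2 first.
- by apply/measurable_EFinP/measurableT_comp.
- exact: integral_ge0.
apply: lte_mul_pinfty => //; first exact: integral_ge0.
by rewrite ge0_fin_numE // integral_ge0.
Qed.

Lemma independent_pair_RintegralM :
  P.-integrable setT (EFin \o U) -> P.-integrable setT (EFin \o V) ->
  \int[P]_w (U w * V w) = (\int[P]_w U w) * \int[P]_w V w.
Proof.
move=> iU iV.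
have iUV := independent_pair_integrableM iU iV.
pose f (z : (R * R)%type) : \bar R := (z.1 * z.2)%:E.
have mf : measurable_fun setT f.
  by apply/measurable_EFinP; exact: measurable_funM.
have iUV' : P.-integrable (UVM @^-1` setT) (f \o UVM) by [].
have if1 : (distribution P UVM).-integrable setT f.
  exact: integrable_pushforward.
have if2 : (distribution P UM \x distribution P VM)%E.-integrable setT f.
  apply/integrableP; split => //.
  rewrite (_ : (\int[_]_x _ = \int[distribution P UVM]_x `|f x|)%E); last first.
    apply: eq_measure_integral => X mX _; first [exact: jointE | exact/esym/jointE].
  by case/integrableP: if1.
rewrite /Rintegral.
transitivity (fine (\int[distribution P UVM]_z f z)%E).
  by rewrite integral_pushforward.
transitivity (fine (\int[distribution P UM \x distribution P VM]_z f z)%E).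
  congr fine; apply: eq_measure_integral => X mX _; first [exact: jointE | exact/esym/jointE].
rewrite -integral12_prod_meas1 //.
have iV1 : (distribution P VM).-integrable setT (EFin : R -> \bar R).
  exact: integrable_pushforward.
have iU1 : (distribution P UM).-integrable setT (EFin : R -> \bar R).
  exact: integrable_pushforward.
have eV : (\int[distribution P VM]_y y%:E = \int[P]_w (V w)%:E)%E.
  by rewrite integral_pushforward.
have eU : (\int[distribution P UM]_y y%:E = \int[P]_w (U w)%:E)%E.
  by rewrite integral_pushforward.
rewrite /fubini_F /f /=.
under eq_integral => x _.
  under eq_integral do rewrite EFinM.
  rewrite integralZl //=.
  over.
have fV : (\int[P]_w (V w)%:E)%E \is a fin_num.
  by rewrite integrable_fin_num.
have fU : (\int[P]_w (U w)%:E)%E \is a fin_num.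
  by rewrite integrable_fin_num.
by rewrite /= eV -(fineK fV) integralZr //= eU fineM.
Qed.

End independent_pairs.

(** Asking for the whole index type only is no loss, since an index is dropped by taking
    [B i = setT]. The index type is any [finType] so that it can be [bool * 'I_n]. *)
Definition independent_family (R : realType) d (T : measurableType d)
    (P : probability T R) (m : nat) (I : finType) (Z : I -> T -> 'rV[R]_m) :=
  forall B : I -> set 'rV[R]_m, (forall i, measurable (B i)) ->
    (P (\bigcap_i (Z i @^-1` B i)) = \prod_i P (Z i @^-1` B i))%E.

Lemma measurable_coord (R : realType) (m : nat) (k : 'I_m) :
  measurable_fun setT (fun x : 'rV[R]_m => x 0 k).
Proof.
apply: (measurability _ (RGenOpens.measurableE R)) => _ [_ [a [b ->]] <-].
rewrite setTI; apply: sub_sigma_algebra => /=.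
apply: open_comp => [x _|]; last exact: interval_open.
exact: coord_continuous.
Qed.

Section independent_families.
Context (R : realType) d (T : measurableType d) (P : probability T R).
Context (m : nat) (I : finType) (Z : I -> T -> 'rV[R]_m).
Hypothesis mZ : forall i, measurable_fun setT (Z i).
Hypothesis indZ : independent_family P Z.

Definition others_cylinder (j : I) : set (set T) :=
  [set E | exists2 B : I -> set 'rV[R]_m, (forall i, measurable (B i)) &
           E = \bigcap_(i in [set i | i != j]) (Z i @^-1` B i)].

Let mpre i B : measurable B -> measurable (Z i @^-1` B).
Proof. by move=> mB; rewrite -[X in measurable X]setTI; exact: mZ. Qed.

Lemma others_cylinder_measurable j : others_cylinder j `<=` measurable.
Proof.
move=> _ [B mB ->]; apply: fin_bigcap_measurable => [|i _]; last exact: mpre.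
exact: finite_finset.
Qed.

Lemma setI_closed_others_cylinder j : setI_closed (others_cylinder j).
Proof.
move=> _ _ [B mB ->] [C mC ->]; exists (fun i => B i `&` C i).
  by move=> i; exact: measurableI.
apply/seteqP; split => w /=.
  by move=> [wB wC] i ij; split; [exact: wB|exact: wC].
by move=> wBC; split => i /wBC[].
Qed.

(* Both sides are finite measures in [E] that agree on the pi-system of
   cylinders. *)
Lemma independent_others j E B : <<s others_cylinder j >> E -> measurable B ->
  (P (E `&` (Z j @^-1` B)) = P E * P (Z j @^-1` B))%E.
Proof.
move=> sE mB; have mF := mpre j mB; set F := Z j @^-1` B in mF *.
have PF : (P F = (fine (P F))%:E)%E by rewrite fineK // fin_num_measure.
have F0 : 0 <= fine (P F) by exact: fine_ge0.
pose r := NngNum F0.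
pose m1 : {measure set T -> \bar R} := mrestr P mF.
pose m2 : {measure set T -> \bar R} := mscale r P.
suff : m1 E = m2 E.
  by rewrite /m1 /m2 /= /mrestr /mscale /= -PF muleC.
move: E sE; apply: (@g_sigma_algebra_measure_unique _ _ _ (others_cylinder j) _
  (fun _ => setT)).
- exact: others_cylinder_measurable.
- move=> _; exists (fun=> setT) => //.
  by apply/seteqP; split.
- by rewrite bigcup_const.
- exact: setI_closed_others_cylinder.
- move=> _ [C mC ->]; rewrite /m1 /m2 /= /mrestr /mscale /= -PF.
  (* [indZ] speaks of all indices at once, so slot [j] is filled by [B] on one side and by the whole
     space on the other. *)
  pose C1 i := if i == j then B else C i.
  pose C2 i := if i == j then setT else C i.
  have mC1 i : measurable (C1 i) by rewrite /C1; case: ifP.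
  have mC2 i : measurable (C2 i) by rewrite /C2; case: ifP.
  have e1 : \bigcap_(i in [set i | i != j]) (Z i @^-1` C i) `&` F =
      \bigcap_i (Z i @^-1` C1 i).
    apply/seteqP; split => w /=.
      move=> [wC wF] i _; rewrite /C1 /=; have [->//|ij] := eqVneq i j.
      exact: wC.
    move=> wC; split; last by have := wC j Logic.I; rewrite /C1 /= eqxx.
    by move=> i /= ij; have := wC i Logic.I; rewrite /C1 /= (negbTE ij).
  have e2 : \bigcap_(i in [set i | i != j]) (Z i @^-1` C i) =
      \bigcap_i (Z i @^-1` C2 i).
    apply/seteqP; split => w /=.
      move=> wC i _; rewrite /C2 /=; have [->//|ij] := eqVneq i j.
      exact: wC.
    by move=> wC i /= ij; have := wC i Logic.I; rewrite /C2 /= (negbTE ij).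
  rewrite e1 e2 !indZ // (bigD1 j) //= [in RHS](bigD1 j) //=.
  rewrite {1}/C1 {1}/C2 eqxx preimage_setT probability_setT mul1e.
  congr (_ * _)%E; apply: eq_bigr => i ij.
  by rewrite /C1 /C2 (negbTE ij).
- by move=> _; rewrite /= /mrestr ltey_eq fin_num_measure //; exact: measurableI.
Qed.

(** Measurability for the sigma-algebra of the other vectors expresses that [U] is a function of
    them. Hybrid sums and partial sums then qualify term by term. *)
Lemma independent_pair_others j (U : T -> R) (h : 'rV[R]_m -> R) :
  measurable_fun (T := g_sigma_algebraType (others_cylinder j)) setT U ->
  measurable_fun setT h -> independent_pair P U (h \o Z j).
Proof.
move=> mU mh A B mA mB; rewrite comp_preimage independent_others //.
  by rewrite -[X in <<s _ >> X]setTI; exact: (mU measurableT).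
by rewrite -[X in measurable X]setTI; exact: mh.
Qed.

Lemma measurable_coord_others j i k : i != j ->
  measurable_fun (T := g_sigma_algebraType (others_cylinder j)) setT
    (fun w => Z i w 0 k).
Proof.
move=> ij _ A mA; rewrite setTI; apply: sub_sigma_algebra.
exists (fun i' => if i' == i then (fun x : 'rV[R]_m => x 0 k) @^-1` A else setT).
  move=> i'; case: ifP => // _.
  by rewrite -[X in measurable X]setTI; exact: measurable_coord.
apply/seteqP; split => w /=.
  by move=> wA i' _; have [->|] := eqVneq i' i.
by move=> /(_ i ij); rewrite eqxx.
Qed.

End independent_families.

(** * Smooth steps *)

Section real_steps.
Context (R : realType).

(** No differentiability is asked for: [p1] and [p2] stand for the first derivative and half the
    second one, and are known only through the remainders. One [k] serves all orders, which makes
    [k * |h|] the natural unit. *)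
Record smooth_step (k : R) (p p1 p2 : R -> R) : Prop := SmoothStep {
  step_ge0 : forall t, 0 <= p t;
  step_le1 : forall t, p t <= 1;
  step_meas : measurable_fun setT p;
  step_meas1 : measurable_fun setT p1;
  step_meas2 : measurable_fun setT p2;
  step_bound1 : forall t, `|p1 t| <= k;
  step_bound2 : forall t, `|p2 t| <= k ^+ 2;
  step_taylor0 : forall t h, `|p (t + h) - p t| <= k * `|h|;
  step_taylor1 : forall t h, `|p (t + h) - p t - p1 t * h| <= (k * `|h|) ^+ 2;
  step_taylor2 : forall t h,
    `|p (t + h) - p t - p1 t * h - p2 t * h ^+ 2| <= (k * `|h|) ^+ 3 }.

Definition posp (t : R) : R := Num.max 0 t.

Lemma posp_ge0E t : 0 <= t -> posp t = t.
Proof. by move=> t0; rewrite /posp max_r. Qed.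

Lemma posp_le0E t : t <= 0 -> posp t = 0.
Proof. by move=> t0; rewrite /posp max_l. Qed.

Lemma measurable_posp : measurable_fun setT posp.
Proof. by apply: measurable_maxr => //; exact: measurable_cst. Qed.

(** Away from the kink the third derivative is 0 or 6, and [6 / 3! = 1] is the constant. The sign
    cases cover increments that cross 0. *)
Lemma posp_cube_taylor t h :
  `|posp (t + h) ^+ 3 - posp t ^+ 3 - 3 * posp t ^+ 2 * h - 3 * posp t * h ^+ 2|
    <= `|h| ^+ 3.
Proof.
have h3 : `|h| ^+ 3 = h ^+ 3 \/ `|h| ^+ 3 = - h ^+ 3.
  by case: (ger0P h) => _; [left|right; ring].
case: (lerP 0 t) => t0; case: (lerP 0 (t + h)) => th0.
- rewrite !posp_ge0E // (_ : _ - _ = h ^+ 3); last by ring.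
  by rewrite normrX.
- rewrite (posp_ge0E t0) (posp_le0E (ltW th0)).
  have h0 : h < 0 by lra.
  rewrite (ltr0_norm h0) ler_norml; apply/andP; split.
    have : 0 <= (- (t + h)) ^+ 3 by apply: exprn_ge0; lra.
    by lra.
  have : (- (t + h)) ^+ 3 <= (- h) ^+ 3 by apply: lerXn2r; rewrite ?nnegrE; lra.
  have : 0 <= (- h) ^+ 3 by apply: exprn_ge0; lra.
  by lra.
- rewrite (posp_ge0E th0) (posp_le0E (ltW t0)).
  have h0 : 0 < h by lra.
  rewrite (gtr0_norm h0) ler_norml; apply/andP; split.
    have : 0 <= (t + h) ^+ 3 by apply: exprn_ge0; lra.
    have : 0 <= h ^+ 3 by apply: exprn_ge0; lra.
    by lra.
  have : (t + h) ^+ 3 <= h ^+ 3 by apply: lerXn2r; rewrite ?nnegrE; lra.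
  by lra.
- rewrite (posp_le0E (ltW th0)) (posp_le0E (ltW t0)) (_ : _ - _ = 0); last by ring.
  by rewrite normr0 exprn_ge0.
Qed.

(* The distribution function of the sum of three independent uniform variables
   on [0, 1]: a cubic spline with knots 0, 1, 2, 3. *)
Definition spline (t : R) : R :=
  (posp t ^+ 3 - 3 * posp (t - 1) ^+ 3 + 3 * posp (t - 2) ^+ 3
   - posp (t - 3) ^+ 3) / 6.

Definition spline1 (t : R) : R :=
  (posp t ^+ 2 - 3 * posp (t - 1) ^+ 2 + 3 * posp (t - 2) ^+ 2
   - posp (t - 3) ^+ 2) / 2.

Definition spline2 (t : R) : R :=
  (posp t - 3 * posp (t - 1) + 3 * posp (t - 2) - posp (t - 3)) / 2.

Let knots (t : R) : t <= 0 \/ 0 <= t <= 1 \/ 1 <= t <= 2 \/ 2 <= t <= 3 \/ 3 <= t.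
Proof.
case: (lerP t 0) => [|t0]; first by left.
case: (lerP t 1) => [t1|t1]; first by right; left; lra.
case: (lerP t 2) => [t2|t2]; first by right; right; left; lra.
case: (lerP t 3) => [t3|t3]; first by right; right; right; left; lra.
by right; right; right; right; lra.
Qed.

(** On [[2, 3]] the closed form uses the symmetry [spline (3 - t) = 1 - spline t], so that [3 - t]
    ranges over [[0, 1]] and [powers] applies there too. *)
Let spline_cases t :
  (spline t = 0 /\ (spline1 t = 0 /\ spline2 t = 0)) \/
      (0 <= t <= 1 /\ (spline t = t ^+ 3 / 6 /\
        (spline1 t = t ^+ 2 / 2 /\ spline2 t = t / 2))) \/
      (1 <= t <= 2 /\ (spline t = (t ^+ 3 - 3 * (t - 1) ^+ 3) / 6 /\
        (spline1 t = (t ^+ 2 - 3 * (t - 1) ^+ 2) / 2 /\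
         spline2 t = (t - 3 * (t - 1)) / 2))) \/
      (2 <= t <= 3 /\ (spline t = 1 - (3 - t) ^+ 3 / 6 /\
        (spline1 t = (3 - t) ^+ 2 / 2 /\ spline2 t = (t - 3) / 2))) \/
    (spline t = 1 /\ (spline1 t = 0 /\ spline2 t = 0)).
Proof.
rewrite /spline /spline1 /spline2.
case: (knots t) => [t0|[/andP[t0 t1]|[/andP[t1 t2]|[/andP[t2 t3]|t3]]]].
- left; have e0 : posp (t) = 0 by apply: posp_le0E; lra.
  have e1 : posp (t - 1) = 0 by apply: posp_le0E; lra.
  have e2 : posp (t - 2) = 0 by apply: posp_le0E; lra.
  have e3 : posp (t - 3) = 0 by apply: posp_le0E; lra.
  rewrite e0 e1 e2 e3.
  by split; [|split]; field.
- right; left; have e0 : posp (t) = t by apply: posp_ge0E; lra.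
  have e1 : posp (t - 1) = 0 by apply: posp_le0E; lra.
  have e2 : posp (t - 2) = 0 by apply: posp_le0E; lra.
  have e3 : posp (t - 3) = 0 by apply: posp_le0E; lra.
  rewrite e0 e1 e2 e3.
  split; first lra.
  by split; [|split]; field.
- right; right; left; have e0 : posp (t) = t by apply: posp_ge0E; lra.
  have e1 : posp (t - 1) = t - 1 by apply: posp_ge0E; lra.
  have e2 : posp (t - 2) = 0 by apply: posp_le0E; lra.
  have e3 : posp (t - 3) = 0 by apply: posp_le0E; lra.
  rewrite e0 e1 e2 e3.
  split; first lra.
  by split; [|split]; field.
- right; right; right; left; have e0 : posp (t) = t by apply: posp_ge0E; lra.
  have e1 : posp (t - 1) = t - 1 by apply: posp_ge0E; lra.
  have e2 : posp (t - 2) = t - 2 by apply: posp_ge0E; lra.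
  have e3 : posp (t - 3) = 0 by apply: posp_le0E; lra.
  rewrite e0 e1 e2 e3.
  split; first lra.
  by split; [|split]; field.
- right; right; right; right; have e0 : posp (t) = t by apply: posp_ge0E; lra.
  have e1 : posp (t - 1) = t - 1 by apply: posp_ge0E; lra.
  have e2 : posp (t - 2) = t - 2 by apply: posp_ge0E; lra.
  have e3 : posp (t - 3) = t - 3 by apply: posp_ge0E; lra.
  rewrite e0 e1 e2 e3.
  by split; [|split]; field.
Qed.

Lemma spline_le0 t : t <= 0 -> spline t = 0.
Proof. by move=> t0; rewrite /spline !posp_le0E; lra. Qed.

Lemma spline_ge3 t : 3 <= t -> spline t = 1.
Proof.
by move=> t3; rewrite /spline !posp_ge0E; lra.
Qed.

Let powers (u : R) : 0 <= u -> u <= 1 ->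
  0 <= u ^+ 2 /\ u ^+ 2 <= u /\ 0 <= u ^+ 3 /\ u ^+ 3 <= u ^+ 2.
Proof.
move=> u0 u1; rewrite !exprn_ge0 // (exprS u 2) (exprS u 1) expr1.
by rewrite ler_piMl // ler_piMl // mulr_ge0.
Qed.

Let spline_bounds t :
  [/\ 0 <= spline t, spline t <= 1, `|spline1 t| <= 1 & `|spline2 t| <= 1].
Proof.
case: (spline_cases t) => [[-> [-> ->]]|[[/andP[t0 t1] [-> [-> ->]]]|
    [[/andP[t0 t1] [-> [-> ->]]]|[[/andP[t0 t1] [-> [-> ->]]]|[-> [-> ->]]]]]].
- by rewrite normr0; split; lra.
- have [t2 [t2' [t3 t3']]] := powers t0 t1.
  by split; rewrite ?ler_norml; lra.
- have u0 : 0 <= t - 1 by lra.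
  have u1 : t - 1 <= 1 by lra.
  have [t2 [t2' [t3 t3']]] := powers u0 u1.
  (* [lra] sees powers as atoms. On this piece [spline1 t = 3 / 4 - (t - 1 - 1 / 2) ^ 2], which [q]
     bounds above; [q'] controls the cubic term in [spline t <= 1]. *)
  have q := sqr_ge0 (t - 1 - 1 / 2).
  have q' := mulr_ge0 u0 (sqr_ge0 (1 - (t - 1))).
  by split; rewrite ?ler_norml; lra.
- have u0 : 0 <= 3 - t by lra.
  have u1 : 3 - t <= 1 by lra.
  have [t2 [t2' [t3 t3']]] := powers u0 u1.
  by split; rewrite ?ler_norml; lra.
- by rewrite normr0; split; lra.
Qed.

(** Four remainders of [posp_cube_taylor] with total weight [(1 + 3 + 3 + 1) / 6 = 4 / 3], rounded
    up to 2. *)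
Let spline_taylor t h :
  `|spline (t + h) - spline t - spline1 t * h - spline2 t * h ^+ 2|
  <= 2 * `|h| ^+ 3.
Proof.
pose c s := posp (s + h) ^+ 3 - posp s ^+ 3 - 3 * posp s ^+ 2 * h
            - 3 * posp s * h ^+ 2.
rewrite (_ : _ - _ = (c t - 3 * c (t - 1) + 3 * c (t - 2) - c (t - 3)) / 6).
  have H s : `|c s| <= `|h| ^+ 3 := posp_cube_taylor s h.
  have := H t; have := H (t - 1); have := H (t - 2); have := H (t - 3).
  have : 0 <= `|h| ^+ 3 by rewrite exprn_ge0.
  rewrite !ler_norml; lra.
rewrite /c /spline /spline1 /spline2.
by rewrite -(addrAC t) -(addrAC t (- 2)) -(addrAC t (- 3)); field.
Qed.

(** Orders zero and one combine the third-order estimate, good for small [h], with the bound 1 on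
    any increment of [spline], good for large [h]. The constant 3 leaves room for both. *)
Lemma smooth_step_spline : smooth_step 3 spline spline1 spline2.
Proof.
have mp n : measurable_fun setT (fun t : R => posp t ^+ n).
  by apply: measurable_funX; exact: measurable_posp.
have mpc c n : measurable_fun setT (fun t : R => posp (t - c) ^+ n).
  apply/measurable_funX/measurableT_comp; first exact: measurable_posp.
  exact: measurable_funB.
have m1 c : measurable_fun setT (fun t : R => posp (t - c)).
  apply: (measurableT_comp measurable_posp).
  exact: measurable_funB.
have sb t h : `|spline (t + h) - spline t| <= 1.
  have [? ? _ _] := spline_bounds t; have [? ? _ _] := spline_bounds (t + h).
  by rewrite ler_norml; lra.
split.
- by move=> t; have [] := spline_bounds t.
- by move=> t; have [] := spline_bounds t.
- apply: measurable_funM => //; apply: measurable_funB => //.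
  apply: measurable_funD; last exact: measurable_funM.
  by apply: measurable_funB => //; exact: measurable_funM.
- apply: measurable_funM => //; apply: measurable_funB => //.
  apply: measurable_funD; last exact: measurable_funM.
  by apply: measurable_funB => //; exact: measurable_funM.
- apply: measurable_funM => //; apply: measurable_funB => //.
  apply: measurable_funD; last exact: measurable_funM.
  by apply: measurable_funB; [exact: measurable_posp|exact: measurable_funM].
- by move=> t; have [_ _ ? _] := spline_bounds t; lra.
- by move=> t; have [_ _ _ ?] := spline_bounds t; lra.
- move=> t h; have [_ _ b1 b2] := spline_bounds t.
  have := spline_taylor t h; have := sb t h.
  have h0 := normr_ge0 h.
  have b1h : `|spline1 t * h| <= `|h| by rewrite normrM ler_piMl.
  have b2h : `|spline2 t * h ^+ 2| <= `|h| ^+ 2.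
    by rewrite normrM normrX ler_piMl // exprn_ge0.
  move: b1h b2h; rewrite !ler_norml; nra.
- move=> t h; have [_ _ b1 b2] := spline_bounds t.
  have := spline_taylor t h; have := sb t h.
  have h0 := normr_ge0 h.
  have b1h : `|spline1 t * h| <= `|h| by rewrite normrM ler_piMl.
  have b2h : `|spline2 t * h ^+ 2| <= `|h| ^+ 2.
    by rewrite normrM normrX ler_piMl // exprn_ge0.
  move: b1h b2h; rewrite !ler_norml; nra.
- move=> t h; apply: le_trans (spline_taylor t h) _.
  have : 0 <= `|h| ^+ 3 by rewrite exprn_ge0.
  by rewrite exprMn; lra.
Qed.

Lemma smooth_step_scale k p p1 p2 l c : 0 < l -> smooth_step k p p1 p2 ->
  smooth_step (k / l) (fun t => p ((t - c) / l)) (fun t => p1 ((t - c) / l) / l)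
    (fun t => p2 ((t - c) / l) / l ^+ 2).
Proof.
move=> l0 [p0 p1' mp mp1 mp2 b1 b2 t0 t1 t2].
have ma : measurable_fun setT (fun t : R => (t - c) / l).
  by apply: measurable_funM => //; exact: measurable_funB.
have li : 0 < l^-1 by rewrite invr_gt0.
have E t h : (t + h - c) / l = (t - c) / l + h / l by field; rewrite gt_eqF.
have N h : k / l * `|h| = k * `|h / l|.
  by rewrite normrM (gtr0_norm li) mulrA mulrAC.
split => //.
- exact: (measurableT_comp mp ma).
- by apply: measurable_funM => //; exact: (measurableT_comp mp1 ma).
- by apply: measurable_funM => //; exact: (measurableT_comp mp2 ma).
- by move=> t; rewrite normrM (gtr0_norm li) ler_pM2r.
- move=> t; rewrite normrM exprMn normfV normrX (gtr0_norm l0) exprVn.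
  by rewrite ler_pM2r // invr_gt0 exprn_gt0.
- by move=> t h; rewrite E N.
- by move=> t h; rewrite E N mulrAC -mulrA.
- by move=> t h; rewrite E N mulrAC -mulrA mulrAC -mulrA -expr_div_n.
Qed.

End real_steps.

(** * Coordinatewise smoothing *)

Section smoothing.
Context (R : realType) (m : nat).
Local Notation vec := 'rV[R]_m.

(* A closure property under random vectors with measurable coordinates, which
   makes it unnecessary to generate the Borel sets of ['rV[R]_m] by boxes. *)
Definition coord_measurable (f : vec -> R) : Prop :=
  forall dO (O : measurableType dO) (V : O -> vec),
    (forall i, measurable_fun setT (fun w => V w 0 i)) ->
    measurable_fun setT (fun w => f (V w)).

(** [N] measures increments and is a parameter because every mixing adds one [|y_i|] to it. [b]
    absorbs the factor 1/2 of the Taylor formula and need not be symmetric. The bounds on [a] and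
    [b] are existential: they serve integrability and never enter an estimate. *)
Record taylor3 (k : R) (N : vec -> R) (f : vec -> R) (a : 'I_m -> vec -> R)
    (b : 'I_m -> 'I_m -> vec -> R) : Prop := Taylor3 {
  taylor_N : forall y : vec, 0 <= N y;
  taylor_ge0 : forall x : vec, 0 <= f x;
  taylor_le1 : forall x : vec, f x <= 1;
  taylor_meas : coord_measurable f;
  taylor_meas1 : forall i, coord_measurable (a i);
  taylor_meas2 : forall i j, coord_measurable (b i j);
  taylor_bound1 : exists M : R, forall i x, `|a i x| <= M;
  taylor_bound2 : exists M : R, forall i j x, `|b i j x| <= M;
  taylor_rem0 : forall x y : vec, `|f (x + y) - f x| <= k * N y;
  taylor_rem1 : forall x y : vec,
    `|f (x + y) - f x - \sum_i a i x * y 0 i| <= (k * N y) ^+ 2;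
  taylor_rem2 : forall x y : vec,
    `|f (x + y) - f x - \sum_i a i x * y 0 i
      - \sum_i \sum_j b i j x * (y 0 i * y 0 j)| <= (k * N y) ^+ 3 }.

Definition smooth3 (k : R) (N f : vec -> R) := exists a b, taylor3 k N f a b.

Lemma smooth3_cst (k : R) (N : vec -> R) (c : R) : 0 <= k -> (forall y, 0 <= N y) -> 0 <= c <= 1 ->
  smooth3 k N (fun=> c).
Proof.
move=> k0 N0 /andP[c0 c1]; exists (fun _ _ => 0), (fun _ _ _ => 0).
have S1 (y : vec) : \sum_i 0 * y 0 i = 0 :> R.
  by apply: big1 => i _; rewrite mul0r.
have S2 (y : vec) : \sum_i \sum_j 0 * (y 0 i * y 0 j) = 0 :> R.
  by apply: big1 => i _; apply: big1 => j _; rewrite mul0r.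
have kN y : 0 <= k * N y by rewrite mulr_ge0.
split => //.
- by move=> i dO O V _; exact: measurable_cst.
- by move=> i j dO O V _; exact: measurable_cst.
- by exists 0 => i x; rewrite normr0.
- by exists 0 => i j x; rewrite normr0.
- by move=> x y; rewrite subrr normr0.
- by move=> x y; rewrite S1 !subr0 subrr normr0 exprn_ge0.
- by move=> x y; rewrite S1 S2 !subr0 subrr normr0 exprn_ge0.
Qed.

(** Two quantities bounded by [A] in a convex combination cost [A] once; this is what spares the
    smoothing a constant that grows with the dimension. *)
Let ler_norm_mix4 (p u v z t s r A B C : R) : 0 <= p <= 1 ->
  `|u| <= A -> `|v| <= A -> `|z| <= B -> `|t| <= C -> 0 <= A ->
  s = p * u + (1 - p) * v + z + t -> A + B + C <= r -> `|s| <= r.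
Proof.
move=> /andP[p0 p1] uA vA zB tC A0 -> h; apply: le_trans h.
apply: (le_trans (ler_normD _ _)); apply: lerD => //.
apply: (le_trans (ler_normD _ _)); apply: lerD => //.
apply: (le_trans (ler_normD _ _)).
rewrite !normrM (ger0_norm p0) (@ger0_norm _ (1 - p)); last lra.
rewrite (_ : A = p * A + (1 - p) * A); last by ring.
by apply: lerD; apply: ler_wpM2l => //; lra.
Qed.

Let ler_norm_mul (x y X Y : R) : `|x| <= X -> `|y| <= Y -> `|x * y| <= X * Y.
Proof. by move=> xX yY; rewrite normrM ler_pM. Qed.

Let ler_norm_mul1 (x y Y : R) : `|x| <= 1 -> `|y| <= Y -> `|x * y| <= Y.
Proof. by move=> x1 yY; rewrite normrM -[Y]mul1r ler_pM. Qed.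

Let ler_normB2 (x y X : R) : `|x| <= X -> `|y| <= X -> `|x - y| <= 2 * X.
Proof.
move=> xX yX; apply: (le_trans (ler_normB _ _)).
by rewrite mulrDl mul1r lerD.
Qed.

Let unit_dist (x y : R) : 0 <= x -> x <= 1 -> 0 <= y -> y <= 1 -> `|x - y| <= 1.
Proof. by move=> *; rewrite ler_norml; lra. Qed.

(* The constants are closed under mixing because
   [A ^ 3 + 2 H A ^ 2 + 2 H ^ 2 A + H ^ 3 <= (A + H) ^ 3]. *)
Lemma smooth3_mix (k : R) (N f g : vec -> R) (p p1 p2 : R -> R) (i0 : 'I_m) :
  0 <= k -> smooth_step k p p1 p2 -> smooth3 k N f -> smooth3 k N g ->
  smooth3 k (fun y => N y + `|y 0 i0|)
    (fun x => p (x 0 i0) * f x + (1 - p (x 0 i0)) * g x).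
Proof.
move=> k0 [P0 P1 mp mp1 mp2 pb1 pb2 pt0 pt1 pt2].
move=> [a [b [N0 f0 f1 mf ma mb [Ma ba] [Mb bb] r0 r1 r2]]].
move=> [a' [b' [_ g0 g1 mg ma' mb' [Ma' ba'] [Mb' bb'] s0 s1 s2]]].
pose q (x : vec) := p (x 0 i0).
have mq (q' : R -> R) : measurable_fun setT q' -> coord_measurable (fun x : vec => q' (x 0 i0)).
  by move=> mq' dO O V mV; exact: (measurableT_comp mq' (mV i0)).
(* The product rule for [g + p (f - g)]. Increments of [p] add [p1 (f - g)] at first order, and
   [p1 (a - a')] and [p2 (f - g)] at second order, all placed in row [i0]. *)
exists (fun i x => q x * a i x + (1 - q x) * a' i x
                + (i == i0)%:R * (p1 (x 0 i0) * (f x - g x))).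
exists (fun i j x => q x * b i j x + (1 - q x) * b' i j x
    + (i == i0)%:R * (p1 (x 0 i0) * (a j x - a' j x))
    + (i == i0)%:R * ((j == i0)%:R * (p2 (x 0 i0) * (f x - g x)))).
have q01 x : 0 <= q x <= 1 by rewrite /q P0 P1.
have fg x : `|f x - g x| <= 1 by exact: unit_dist.
have delta1 (F : 'I_m -> R) : \sum_i (i == i0)%:R * F i = F i0.
  rewrite (bigD1 i0) //= eqxx mul1r big1 ?addr0 // => i ii0.
  by rewrite (negbTE ii0) mul0r.
have A1 (x y : vec) : \sum_i (q x * a i x + (1 - q x) * a' i x
        + (i == i0)%:R * (p1 (x 0 i0) * (f x - g x))) * y 0 i =
    q x * (\sum_i a i x * y 0 i) + (1 - q x) * (\sum_i a' i x * y 0 i)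
    + p1 (x 0 i0) * y 0 i0 * (f x - g x).
  rewrite -[in RHS]mulrAC -(delta1 (fun i => p1 (x 0 i0) * (f x - g x) * y 0 i)).
  rewrite !mulr_sumr -!big_split /=; apply: eq_bigr => i _; ring.
have B1 (x y : vec) : \sum_i \sum_j (q x * b i j x + (1 - q x) * b' i j x
    + (i == i0)%:R * (p1 (x 0 i0) * (a j x - a' j x))
    + (i == i0)%:R * ((j == i0)%:R * (p2 (x 0 i0) * (f x - g x))))
      * (y 0 i * y 0 j) =
    q x * (\sum_i \sum_j b i j x * (y 0 i * y 0 j))
    + (1 - q x) * (\sum_i \sum_j b' i j x * (y 0 i * y 0 j))
    + p1 (x 0 i0) * y 0 i0 * (\sum_i a i x * y 0 i - \sum_i a' i x * y 0 i)
    + p2 (x 0 i0) * y 0 i0 ^+ 2 * (f x - g x).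
  have -> : p1 (x 0 i0) * y 0 i0 * (\sum_i a i x * y 0 i - \sum_i a' i x * y 0 i)
    = \sum_i (i == i0)%:R * (\sum_j p1 (x 0 i0) * (a j x - a' j x) * (y 0 i * y 0 j)).
    rewrite delta1 -sumrB mulr_sumr; apply: eq_bigr => j _; ring.
  have -> : p2 (x 0 i0) * y 0 i0 ^+ 2 * (f x - g x) =
     \sum_i (i == i0)%:R * (\sum_j (j == i0)%:R *
        (p2 (x 0 i0) * (f x - g x) * (y 0 i * y 0 j))).
    by rewrite delta1 delta1; ring.
  rewrite !mulr_sumr -!big_split /=; apply: eq_bigr => i _.
  rewrite !mulr_sumr -!big_split /=; apply: eq_bigr => j _; ring.
split => //.
- by move=> y; rewrite addr_ge0.
- by move=> x; have /andP[] := q01 x => *; rewrite addr_ge0 // mulr_ge0 //; rewrite subr_ge0.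
- move=> x; have /andP[u v] := q01 x; rewrite /q in u v.
  have := f1 x; have := g1 x; nra.
- move=> dO O V mV; apply: measurable_funD; apply: measurable_funM; try exact: mf; try exact: mg.
    exact: (mq _ mp).
  by apply: measurable_funB => //; exact: (mq _ mp).
- move=> i dO O V mV; apply: measurable_funD; first apply: measurable_funD.
  + by apply: measurable_funM; [exact: (mq _ mp)|exact: ma].
  + apply: measurable_funM; last exact: ma'.
    by apply: measurable_funB => //; exact: (mq _ mp).
  + apply: measurable_funM => //; apply: measurable_funM; first exact: (mq _ mp1).
    by apply: measurable_funB; [exact: mf|exact: mg].
- move=> i j dO O V mV; apply: measurable_funD; first apply: measurable_funD;
    first apply: measurable_funD.
  + by apply: measurable_funM; [exact: (mq _ mp)|exact: mb].
  + apply: measurable_funM; last exact: mb'.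
    by apply: measurable_funB => //; exact: (mq _ mp).
  + apply: measurable_funM => //; apply: measurable_funM; first exact: (mq _ mp1).
    by apply: measurable_funB; [exact: ma|exact: ma'].
  + do 2 (apply: measurable_funM => //); apply: measurable_funM; first exact: (mq _ mp2).
    by apply: measurable_funB; [exact: mf|exact: mg].
- exists (Ma + Ma' + k) => i x; have /andP[u v] := q01 x.
  apply: (le_trans (ler_normD _ _)); apply: lerD.
    apply: (le_trans (ler_normD _ _)); apply: lerD; apply: ler_norm_mul1 => //.
      by rewrite ger0_norm.
    by rewrite ger0_norm; lra.
  apply: ler_norm_mul1; first by case: eqP; rewrite ?normr1 ?normr0.
  by rewrite mulrC; exact: ler_norm_mul1.
- exists (Mb + Mb' + k * (Ma + Ma') + k ^+ 2) => i j x; have /andP[u v] := q01 x.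
  have d1 (c : 'I_m) : `|(c == i0)%:R : R| <= 1.
    by case: eqP; rewrite ?normr1 ?normr0.
  apply: (le_trans (ler_normD _ _)); apply: lerD.
    apply: (le_trans (ler_normD _ _)); apply: lerD.
      apply: (le_trans (ler_normD _ _)); apply: lerD; apply: ler_norm_mul1 => //.
        by rewrite ger0_norm.
      by rewrite ger0_norm; lra.
    apply: ler_norm_mul1 => //; apply: ler_norm_mul => //.
    by apply: (le_trans (ler_normB _ _)); exact: lerD.
  do 2 (apply: ler_norm_mul1 => //).
  by rewrite mulrC; exact: ler_norm_mul1.
- move=> x y; have [h1 h2] := (r0 x y, s0 x y).
  have h3 := pt0 (x 0 i0) (y 0 i0).
  apply: (@ler_norm_mix4 (q x) _ _ _ 0 _ _ _ _ 0 (q01 x) h1 h2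
    (ler_norm_mul h3 (fg (x + y)))).
  + by rewrite normr0.
  + by rewrite mulr_ge0.
  + by rewrite /q mxE; ring.
  + by rewrite mulr1 addr0 mulrDr.
- move=> x y; have [h1 h2] := (r1 x y, s1 x y).
  have h3 := pt1 (x 0 i0) (y 0 i0).
  have h4 : `|p1 (x 0 i0) * y 0 i0| <= k * `|y 0 i0| by rewrite normrM ler_wpM2r.
  have h5 := ler_normB2 (r0 x y) (s0 x y).
  apply: (@ler_norm_mix4 (q x) _ _ _ _ _ _ _ _ _ (q01 x) h1 h2
    (ler_norm_mul h4 h5) (ler_norm_mul h3 (fg (x + y)))).
  + by rewrite exprn_ge0 // mulr_ge0.
  + by rewrite A1 /q mxE; ring.
  + by rewrite le_eqVlt; apply/orP; left; apply/eqP; ring.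
(* Each order of [p] meets the complementary order of [f - g]: [p1] its first-order remainder, [p2]
   its increment, and the remainder of [p] the bound [|f - g| <= 1]. *)
- move=> x y; have [h1 h2] := (r2 x y, s2 x y).
  have h3 := pt2 (x 0 i0) (y 0 i0).
  have h4 : `|p1 (x 0 i0) * y 0 i0| <= k * `|y 0 i0| by rewrite normrM ler_wpM2r.
  have h4' : `|p2 (x 0 i0) * y 0 i0 ^+ 2| <= (k * `|y 0 i0|) ^+ 2.
    by rewrite normrM normrX exprMn ler_wpM2r // exprn_ge0.
  have h5 := ler_normB2 (r0 x y) (s0 x y).
  have h5' := ler_normB2 (r1 x y) (s1 x y).
  have h6 := le_trans (ler_normD _ _) (lerD (ler_norm_mul h4 h5') (ler_norm_mul h4' h5)).
  apply: (@ler_norm_mix4 (q x) _ _ _ _ _ _ _ _ _ (q01 x) h1 h2 h6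
    (ler_norm_mul h3 (fg (x + y)))).
  + by rewrite exprn_ge0 // mulr_ge0.
  + by rewrite A1 B1 /q mxE; ring.
  + have u0 : 0 <= k * N y by rewrite mulr_ge0.
    have v0 : 0 <= k * `|y 0 i0| by rewrite mulr_ge0.
    have w1 := mulr_ge0 u0 (mulr_ge0 v0 v0).
    have w2 := mulr_ge0 v0 (mulr_ge0 u0 u0).
    by rewrite mulrDr; set A := k * N y in w1 w2 *; set H := k * `|_| in w1 w2 *; lra.
Qed.

Section coordinatewise.
Variables (k : R) (p p1 p2 : 'I_m -> R -> R).
Hypotheses (k0 : 0 <= k) (hp : forall i, smooth_step k (p i) (p1 i) (p2 i)).

(** For a duplicate-free [l] this is the multilinear extension of [chi]: its mean when the bits in
    [l] are independent and bit [i] is true with probability [p i (x 0 i)]. [s] carries the bits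
    already chosen and the defaults of the others. *)
Fixpoint smoothing (l : seq 'I_m) (chi : ('I_m -> bool) -> R)
    (s : 'I_m -> bool) (x : vec) : R :=
  if l is i :: l' then
    p i (x 0 i) * smoothing l' chi (fun j => if j == i then true else s j) x +
    (1 - p i (x 0 i)) *
      smoothing l' chi (fun j => if j == i then false else s j) x
  else chi s.

Lemma smooth3_smoothing (l : seq 'I_m) (chi : ('I_m -> bool) -> R)
    (s : 'I_m -> bool) : (forall s, 0 <= chi s <= 1) ->
  smooth3 k (fun y => \sum_(i <- l) `|y 0 i|) (smoothing l chi s).
Proof.
move=> chi01; elim: l s => [|i l IH] s /=.
  by apply: smooth3_cst => // y; rewrite big_nil.
rewrite (_ : (fun y : vec => \sum_(j <- i :: l) `|y 0 j|) =
   (fun y => \sum_(j <- l) `|y 0 j| + `|y 0 i|)); last first.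
  by apply/funext => y; rewrite big_cons addrC.
exact: (smooth3_mix i k0 (hp i) (IH _) (IH _)).
Qed.

(** When every step has reached 0 or 1, a single branch of the recursion keeps a nonzero weight. *)
Lemma smoothing_eq (l : seq 'I_m) (chi : ('I_m -> bool) -> R)
    (s e : 'I_m -> bool) (x : vec) :
  (forall i, i \in l -> p i (x 0 i) = (e i)%:R) ->
  smoothing l chi s x = chi (fun i => if i \in l then e i else s i).
Proof.
elim: l s => [|i l IH] s H /=; first by [].
have Hl j : j \in l -> p j (x 0 j) = (e j)%:R.
  by move=> jl; apply: H; rewrite inE jl orbT.
rewrite !IH // H ?mem_head //.
have E c : e i = c -> (fun j => if j \in l then e j else if j == i then c else s j)
    = (fun j => if j \in i :: l then e j else s j).
  move=> eic; apply/funext => j; rewrite inE; case: (j \in l); first by rewrite orbT.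
  by rewrite orbF; case: eqP => // ->.
by case ei: (e i); rewrite ?(E _ ei) /= ?subr0 ?subrr; ring.
Qed.

End coordinatewise.

End smoothing.

(** * Lindeberg replacement *)

Section real_expectations.
Context (R : realType) d (T : measurableType d) (P : probability T R).
Implicit Types f g : T -> R.

Definition intble f := P.-integrable setT (EFin \o f).

Lemma intbleD f g : intble f -> intble g -> intble (fun w => f w + g w).
Proof. by move=> hf hg; exact: (integrableD measurableT hf hg). Qed.

Lemma intbleB f g : intble f -> intble g -> intble (fun w => f w - g w).
Proof. by move=> hf hg; exact: (integrableB measurableT hf hg). Qed.

Lemma intbleZ c f : intble f -> intble (fun w => c * f w).
Proof. by move=> hf; exact: (integrableZl measurableT c hf). Qed.

Lemma intble_sum (I : finType) (F : I -> T -> R) :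
  (forall i, intble (F i)) -> intble (fun w => \sum_i F i w).
Proof.
move=> hF; rewrite /intble (_ : _ \o _ = (fun w => \sum_i (F i w)%:E)%E).
  by apply: integrable_sum => // i _; exact: hF.
by apply/funext => w /=; rewrite sumEFin.
Qed.

Lemma intble_cst (c : R) : intble (fun=> c).
Proof. exact: finite_measure_integrable_cst. Qed.

Lemma intble_le f g : measurable_fun setT f -> (forall w, `|f w| <= g w) ->
  intble g -> intble f.
Proof.
move=> mf fg; apply: le_integrable => //; first exact/measurable_EFinP.
by move=> w _ /=; rewrite lee_fin (le_trans (fg w)) // ler_norm.
Qed.

Lemma intble_bounded f (M : R) : measurable_fun setT f ->
  (forall w, `|f w| <= M) -> intble f.
Proof.
move=> mf fM; apply: (intble_le mf fM).
exact: finite_measure_integrable_cst.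
Qed.

Lemma intble_meas f : intble f -> measurable_fun setT f.
Proof. by move=> /measurable_int/measurable_EFinP. Qed.

Lemma Rintegral_sum (I : finType) (F : I -> T -> R) :
  (forall i, intble (F i)) ->
  \int[P]_w (\sum_i F i w) = \sum_i \int[P]_w F i w.
Proof.
move=> hF; rewrite /Rintegral.
under eq_integral do rewrite -sumEFin.
rewrite integral_sum // sum_fine // => i _.
by apply: integrable_fin_num => //; exact: hF.
Qed.

Lemma Rintegral_le f g : intble f -> intble g -> (forall w, f w <= g w) ->
  \int[P]_w f w <= \int[P]_w g w.
Proof. by move=> hf hg fg; apply: le_Rintegral. Qed.

Lemma Rintegral_const (c : R) : \int[P]_w c = c.
Proof.
rewrite Rintegral_cst // -[RHS]mulr1; congr (_ * _).
by rewrite -[RHS]/(fine 1%E); congr fine; exact: probability_setT.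
Qed.

End real_expectations.

Section one_replacement.
Context (R : realType) d (T : measurableType d) (P : probability T R) (m : nat).
Local Notation vec := 'rV[R]_m.
Variables (U Y : T -> vec).
Hypothesis mU : forall i, measurable_fun setT (fun w => U w 0 i).
Hypothesis mY : forall i, measurable_fun setT (fun w => Y w 0 i).
Hypothesis UY1 : forall u : vec -> R, coord_measurable u ->
  forall i, independent_pair P (fun w => u (U w)) (fun w => Y w 0 i).
Hypothesis UY2 : forall u : vec -> R, coord_measurable u ->
  forall i j, independent_pair P (fun w => u (U w)) (fun w => Y w 0 i * Y w 0 j).
Hypothesis iY1 : forall i, intble P (fun w => Y w 0 i).
Hypothesis iY2 : forall i j, intble P (fun w => Y w 0 i * Y w 0 j).

(** Expand at [U] and integrate. Independence factors each term, so up to the third-order error the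
    law of [Y] enters only through its first two moments. *)
Lemma taylor3_expectation k N f a b : taylor3 k N f a b ->
  intble P (fun w => N (Y w) ^+ 3) ->
  `| \int[P]_w f (U w + Y w) - \int[P]_w f (U w)
     - \sum_i (\int[P]_w a i (U w)) * \int[P]_w Y w 0 i
     - \sum_i \sum_j (\int[P]_w b i j (U w)) * \int[P]_w (Y w 0 i * Y w 0 j) |
  <= k ^+ 3 * \int[P]_w N (Y w) ^+ 3.
Proof.
move=> [N0 f0 f1 mf ma mb [Ma ba] [Mb bb] _ _ r2] iN.
have ifU : intble P (fun w => f (U w)).
  by apply: (@intble_bounded _ _ _ _ _ 1); [exact: mf|move=> w; rewrite ger0_norm].
have ifUY : intble P (fun w => f (U w + Y w)).
  apply: (@intble_bounded _ _ _ _ _ 1); last by move=> w; rewrite ger0_norm.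
  apply: mf => i; under [X in measurable_fun _ X]eq_fun do rewrite mxE.
  exact: measurable_funD.
have ia i : intble P (fun w => a i (U w)).
  by apply: (@intble_bounded _ _ _ _ _ Ma); [exact: ma|].
have ib i j : intble P (fun w => b i j (U w)).
  by apply: (@intble_bounded _ _ _ _ _ Mb); [exact: mb|].
have iaY i : intble P (fun w => a i (U w) * Y w 0 i).
  by apply: independent_pair_integrableM => //; [exact: ma|exact: UY1|exact: ia|exact: iY1].
have mYY i j : measurable_fun setT (fun w => Y w 0 i * Y w 0 j).
  exact: measurable_funM.
have ibY i j : intble P (fun w => b i j (U w) * (Y w 0 i * Y w 0 j)).
  by apply: independent_pair_integrableM => //; [exact: mb|exact: UY2|exact: ib|exact: iY2].
have e1 : \sum_i (\int[P]_w a i (U w)) * \int[P]_w Y w 0 i =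
    \int[P]_w (\sum_i a i (U w) * Y w 0 i).
  rewrite Rintegral_sum //; apply: eq_bigr => i _.
  by rewrite independent_pair_RintegralM //; [exact: ma|exact: UY1|exact: ia|exact: iY1].
have e2 : \sum_i \sum_j (\int[P]_w b i j (U w)) * \int[P]_w (Y w 0 i * Y w 0 j) =
    \int[P]_w (\sum_i \sum_j b i j (U w) * (Y w 0 i * Y w 0 j)).
  rewrite Rintegral_sum; last by move=> i; exact: intble_sum.
  apply: eq_bigr => i _; rewrite Rintegral_sum //; apply: eq_bigr => j _.
  apply/esym/independent_pair_RintegralM => //; [exact: mb|exact: UY2|exact: ib|exact: iY2].
have is1 : intble P (fun w => \sum_i a i (U w) * Y w 0 i) by exact: intble_sum.
have is2 : intble P (fun w => \sum_i \sum_j b i j (U w) * (Y w 0 i * Y w 0 j)).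
  by apply: intble_sum => i; exact: intble_sum.
rewrite e1 e2 -RintegralB // -RintegralB //; last exact: intbleB.
rewrite -RintegralB //; last by do ! apply: intbleB.
set D := fun w : T => _.
have iD : intble P D by do ! apply: intbleB.
apply: (le_trans (le_normr_Rintegral measurableT iD)).
rewrite -RintegralZl //; apply: le_Rintegral => //.
- by apply: integrable_norm.
- exact: intbleZ.
- by move=> w _; apply: (le_trans (r2 _ _)); rewrite exprMn.
Qed.

End one_replacement.

Section lindeberg.
Context (R : realType) d (T : measurableType d) (P : probability T R) (m n : nat).
Local Notation vec := 'rV[R]_m.
Variable Z : bool * 'I_n -> T -> vec.
Hypothesis mZ : forall i, measurable_fun setT (Z i).
Hypothesis indZ : independent_family P Z.
Hypothesis iZ1 : forall i a, intble P (fun w => Z i w 0 a).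
Hypothesis iZ2 : forall i a b, intble P (fun w => Z i w 0 a * Z i w 0 b).
Hypothesis eZ1 : forall j a,
  \int[P]_w Z (true, j) w 0 a = \int[P]_w Z (false, j) w 0 a.
Hypothesis eZ2 : forall j a b,
  \int[P]_w (Z (true, j) w 0 a * Z (true, j) w 0 b) =
  \int[P]_w (Z (false, j) w 0 a * Z (false, j) w 0 b).

Let mcoord i a : measurable_fun setT (fun w => Z i w 0 a).
Proof. exact: (measurableT_comp (measurable_coord a) (mZ i)). Qed.

(* Hybrid sums: [mix k] has replaced the first [k] vectors. *)
Let mix (k : nat) (i : 'I_n) : T -> vec := Z (~~ (i < k)%N, i).

(** What hybrids [k] and [k + 1] have in common. It involves neither vector of index [k], hence is
    independent of each of them. *)
Let rest (k : 'I_n) (w : T) : vec := \sum_(i | i != k) mix k i w.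

Let rest_others b (k : 'I_n) (a : 'I_m) :
  measurable_fun (T := g_sigma_algebraType (others_cylinder Z (b, k))) setT
    (fun w => rest k w 0 a).
Proof.
under [X in measurable_fun _ X]eq_fun do rewrite /rest summxE big_mkcond.
apply: measurable_sum => i; case: eqVneq => [_|ik]; first exact: measurable_cst.
apply: measurable_coord_others; apply: contra_neq ik => -[_ //].
Qed.

Let rest_indep b (k : 'I_n) (u : vec -> R) (h : vec -> R) :
  coord_measurable u -> measurable_fun setT h ->
  independent_pair P (fun w => u (rest k w)) (h \o Z (b, k)).
Proof.
move=> mu mh; apply: independent_pair_others => //.
by apply: mu => a; exact: rest_others.
Qed.

Lemma lindeberg (k : R) (N f : vec -> R) : 0 <= k -> smooth3 k N f ->
  (forall i, intble P (fun w => N (Z i w) ^+ 3)) ->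
  `| \int[P]_w f (\sum_j Z (true, j) w) - \int[P]_w f (\sum_j Z (false, j) w) |
  <= k ^+ 3 * \sum_j (\int[P]_w N (Z (true, j) w) ^+ 3
                      + \int[P]_w N (Z (false, j) w) ^+ 3).
Proof.
move=> k0 [a [b H]] iN.
pose E (i : nat) := \int[P]_w f (\sum_j mix i j w).
have -> : \int[P]_w f (\sum_j Z (true, j) w) = E 0%N.
  by apply: eq_Rintegral => w _; congr f; apply: eq_bigr.
have -> : \int[P]_w f (\sum_j Z (false, j) w) = E n.
  by apply: eq_Rintegral => w _; congr f; apply: eq_bigr => j _; rewrite /mix ltn_ord.
rewrite distrC -(telescope_sumr E (leq0n n)) big_mkord mulr_sumr.
apply: (le_trans (ler_norm_sum _ _ _)); apply: ler_sum => j _.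
have mrest i : measurable_fun setT (fun w => rest j w 0 i).
  under [X in measurable_fun _ X]eq_fun do rewrite /rest summxE big_mkcond.
  by apply: measurable_sum => i'; case: eqVneq => [_|_]; [exact: measurable_cst|exact: mcoord].
have step b' : `| \int[P]_w f (rest j w + Z (b', j) w) - \int[P]_w f (rest j w)
     - \sum_i (\int[P]_w a i (rest j w)) * \int[P]_w Z (b', j) w 0 i
     - \sum_i \sum_j' (\int[P]_w b i j' (rest j w)) *
         \int[P]_w (Z (b', j) w 0 i * Z (b', j) w 0 j') |
  <= k ^+ 3 * \int[P]_w N (Z (b', j) w) ^+ 3.
  apply: (taylor3_expectation mrest _ _ _ _ _ H) => //.
  - by move=> u mu i; exact: (rest_indep b' j mu (measurable_coord i)).
  - move=> u mu i1 i2.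
    exact: (rest_indep b' j mu (measurable_funM (measurable_coord i1) (measurable_coord i2))).
have e1 : E j = \int[P]_w f (rest j w + Z (true, j) w).
  apply: eq_Rintegral => w _; rewrite (bigD1 j) //= addrC; congr (f (_ + _)).
  by rewrite /mix ltnn.
have e2 : E j.+1 = \int[P]_w f (rest j w + Z (false, j) w).
  apply: eq_Rintegral => w _; rewrite (bigD1 j) //= addrC; congr (f (_ + _)).
    apply: eq_bigr => i ij; rewrite /mix ltnS leq_eqVlt.
    by rewrite (negbTE (_ : nat_of_ord i != j)).
  by rewrite /mix ltnSn.
have e3 : \sum_i (\int[P]_w a i (rest j w)) * \int[P]_w Z (true, j) w 0 i =
    \sum_i (\int[P]_w a i (rest j w)) * \int[P]_w Z (false, j) w 0 i.
  by apply: eq_bigr => i _; rewrite eZ1.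
have e4 : \sum_i \sum_j' (\int[P]_w b i j' (rest j w)) *
         \int[P]_w (Z (true, j) w 0 i * Z (true, j) w 0 j') =
    \sum_i \sum_j' (\int[P]_w b i j' (rest j w)) *
         \int[P]_w (Z (false, j) w 0 i * Z (false, j) w 0 j').
  by apply: eq_bigr => i _; apply: eq_bigr => j' _; rewrite eZ2.
(* After matching moments, both expansions around [rest j] have the same terms of orders zero, one
   and two, so consecutive hybrids differ by two remainders only. *)
have := step true; have := step false; rewrite -e1 -e2 e3 e4.
set S1 := \sum_i _; set S2 := \sum_i _.
rewrite mulrDr => h2 h1.
rewrite (_ : E j.+1 - E j = (E j.+1 - \int[P]_w f (rest j w) - S2 - S1) -
    (E j - \int[P]_w f (rest j w) - S2 - S1)); last by ring.
by apply: (le_trans (ler_normB _ _)); rewrite [leRHS]addrC; exact: lerD.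
Qed.

End lindeberg.

(** * Gaussian variables *)

Section normal_integrals.
Context (R : realType).
Local Notation leb := (@lebesgue_measure R).

(** Change of variables is available for the Radon-Nikodym derivative, which agrees almost
    everywhere with [normal_pdf] because both have the same integral over every measurable set. *)
Lemma ge0_integral_normal_prob (m s : R) (f : R -> \bar R) :
  measurable_fun setT f -> (forall x, 0 <= f x)%E ->
  (\int[normal_prob m s]_x f x = \int[leb]_x (f x * (normal_pdf m s x)%:E))%E.
Proof.
move=> mf f0; have dom := @normal_prob_dominates R m s.
rewrite -(Radon_Nikodym_SigmaFinite.change_of_variables dom) //.
have mn : measurable_fun setT (fun x => (normal_pdf m s x)%:E).
  by apply/measurable_EFinP; exact: measurable_normal_pdf.
apply: ae_eq_integral => //.
- apply: emeasurable_funM => //.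
  exact: measurable_int (Radon_Nikodym_SigmaFinite.f_integrable dom).
- exact: emeasurable_funM.
- apply: ae_eqe_mul2l; apply: integral_ae_eq => //.
  + exact: Radon_Nikodym_SigmaFinite.f_integrable.
  + by move=> A _ mA; rewrite -Radon_Nikodym_SigmaFinite.f_integral.
Qed.

Lemma normal_peak_mul (s b : R) : s != 0 -> 0 < b ->
  normal_peak s = Num.sqrt (b / s ^+ 2) * normal_peak (Num.sqrt b).
Proof.
move=> s0 b0; rewrite /normal_peak sqr_sqrtr; last exact: ltW.
have s2 : 0 < s ^+ 2 by rewrite exprn_even_gt0.
have := @pi_gt0 R; move: (@pi R) => p p0.
have q1 : 0 < b * p *+ 2 by rewrite pmulrn_lgt0 // mulr_gt0.
have q2 : 0 < s ^+ 2 * p *+ 2 by rewrite pmulrn_lgt0 // mulr_gt0.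
rewrite -sqrtrV ?ltW // -sqrtrV ?ltW // -sqrtrM; last by rewrite ltW // divr_gt0.
congr Num.sqrt; rewrite -!(mulr_natr (_ * p)).
by field; rewrite ?s0 ?gt_eqF.
Qed.

Lemma integral_gauss_normal_pdf (a s m c : R) : 0 < a -> s != 0 ->
  (\int[leb]_x ((expR (- (x + c) ^+ 2 / (2 * a)))%:E * (normal_pdf m s x)%:E) =
   (Num.sqrt (a / (a + s ^+ 2)) *
     expR (- (m + c) ^+ 2 / (2 * (a + s ^+ 2))))%:E)%E.
Proof.
move=> a0 s0; have s2 : 0 < s ^+ 2 by rewrite exprn_even_gt0.
have as0 : 0 < a + s ^+ 2 by rewrite addr_gt0.
(* Completing the square: the precisions add, [1 / b = 1 / a + 1 / s ^ 2], and [m'] is the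
   precision-weighted mean of [m] and [- c]. *)
pose b := a * s ^+ 2 / (a + s ^+ 2).
have b0 : 0 < b by rewrite divr_gt0 // mulr_gt0.
pose m' := (m * a - c * s ^+ 2) / (a + s ^+ 2).
have sb0 : Num.sqrt b != 0 by rewrite gt_eqF // sqrtr_gt0.
pose K := Num.sqrt (a / (a + s ^+ 2)) * expR (- (m + c) ^+ 2 / (2 * (a + s ^+ 2))).
have E x : expR (- (x + c) ^+ 2 / (2 * a)) * normal_pdf m s x =
    K * normal_pdf m' (Num.sqrt b) x.
  rewrite !normal_pdfE // (normal_peak_mul s0 b0) /normal_fun sqr_sqrtr ?ltW //.
  have -> : b / s ^+ 2 = a / (a + s ^+ 2) by rewrite /b; field; rewrite ?s0 ?gt_eqF.
  rewrite /K; set S := Num.sqrt (a / _); set pk := normal_peak _.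
  set eA := (X in expR X * (_ * _)); set eB := (X in _ * (_ * expR X)).
  set eC := (X in _ = _ * expR X * _); set eD := (X in _ = _ * (_ * expR X)).
  have H : expR eA * expR eB = expR eC * expR eD.
    rewrite -!expRD; congr expR; rewrite /eA /eB /eC /eD.
    rewrite -(mulr_natr b) -(mulr_natr (s ^+ 2)) /m' /b; field.
    by rewrite ?s0 ?gt_eqF.
  transitivity (S * pk * (expR eA * expR eB)); first by ring.
  by rewrite H; ring.
under eq_integral do rewrite -EFinM E EFinM.
rewrite integralZl //; last exact: integrable_normal_pdf.
by rewrite integral_normal_pdf mule1.
Qed.

(** Exponential tilting shifts the mean of the density by [c s ^ 2] and leaves its variance
    unchanged. *)
Lemma integral_exp_normal_pdf (s m c : R) : s != 0 ->
  (\int[leb]_x ((expR (c * x))%:E * (normal_pdf m s x)%:E) =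
   (expR (c * m + c ^+ 2 * s ^+ 2 / 2))%:E)%E.
Proof.
move=> s0; have s2 : 0 < s ^+ 2 by rewrite exprn_even_gt0.
have E x : expR (c * x) * normal_pdf m s x =
    expR (c * m + c ^+ 2 * s ^+ 2 / 2) * normal_pdf (m + c * s ^+ 2) s x.
  rewrite !normal_pdfE // mulrCA [RHS]mulrCA /normal_fun; congr (_ * _).
  rewrite -!expRD; congr expR; rewrite -(mulr_natr (s ^+ 2)); field.
  by rewrite ?s0 ?gt_eqF.
under eq_integral do rewrite -EFinM E EFinM.
rewrite integralZl //; last exact: integrable_normal_pdf.
by rewrite integral_normal_pdf mule1.
Qed.

End normal_integrals.

Section normal_variables.
Context (R : realType) d (T : measurableType d) (P : probability T R).

Definition has_normal_law (g : T -> R) (m s : R) : Prop :=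
  forall B : set R, measurable B -> P (g @^-1` B) = normal_law m s B.

Variables (g : T -> R) (m s : R).
Hypotheses (mg : measurable_fun [set: T] g) (gms : has_normal_law g m s).

Let gM : {mfun T >-> R} := mfun_Sub (mem_set mg : g \in mfun).

Lemma ge0_integral_normal_law (f : R -> \bar R) :
  measurable_fun setT f -> (forall x, 0 <= f x)%E ->
  (\int[P]_w f (g w) = if s == 0%R then f m
    else \int[lebesgue_measure]_x (f x * (normal_pdf m s x)%:E))%E.
Proof.
move=> mf f0; transitivity (\int[distribution P gM]_x f x)%E.
  by rewrite ge0_integral_distribution.
move: gms; rewrite /has_normal_law /normal_law; case: ifPn => s0 law.
  transitivity (\int[\d_m]_x f x)%E.
    by apply: eq_measure_integral => A mA _; exact: law.
  by rewrite integral_dirac // diracT mul1e.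
rewrite -ge0_integral_normal_prob //.
have mg' : measurable_fun (U := measurableTypeR R) setT g by exact: mg.
pose g' : {mfun T >-> measurableTypeR R} := HB.pack g
  (@isMeasurableFun.Build _ _ T (measurableTypeR R) g mg').
transitivity (\int[distribution P g']_x f x)%E.
  by rewrite !ge0_integral_distribution.
by apply: eq_measure_integral => A mA _; exact: law.
Qed.

Lemma integral_gauss_normal_law (a c : R) : 0 < a ->
  (\int[P]_w (expR (- (g w + c) ^+ 2 / (2 * a)))%:E =
  (Num.sqrt (a / (a + s ^+ 2)) *
     expR (- (m + c) ^+ 2 / (2 * (a + s ^+ 2))))%:E)%E.
Proof.
move=> a0; pose f x := (expR (- (x + c) ^+ 2 / (2 * a)))%:E.
rewrite -[LHS]/(\int[P]_w f (g w))%E ge0_integral_normal_law.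
- case: eqVneq => [->|s0]; last by rewrite integral_gauss_normal_pdf.
  by rewrite expr0n /= addr0 divff ?gt_eqF // sqrtr1 mul1r.
- apply/measurable_EFinP/measurableT_comp => //; apply: measurable_funM => //.
  apply: measurableT_comp => //; apply: measurable_funX.
  exact: measurable_funD.
- by move=> x; rewrite lee_fin expR_ge0.
Qed.

Lemma integral_exp_normal_law (c : R) :
  (\int[P]_w (expR (c * g w))%:E = (expR (c * m + c ^+ 2 * s ^+ 2 / 2))%:E)%E.
Proof.
pose f x := (expR (c * x))%:E.
rewrite -[LHS]/(\int[P]_w f (g w))%E ge0_integral_normal_law.
- case: eqVneq => [->|s0]; last by rewrite integral_exp_normal_pdf.
  by rewrite expr0n /= mulr0 mul0r addr0.
- by apply/measurable_EFinP/measurableT_comp => //; exact: measurable_funM.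
- by move=> x; rewrite lee_fin expR_ge0.
Qed.

End normal_variables.

(** * Moment bounds for one normal variable *)

Section normal_moments.
Context (R : realType) d (T : measurableType d) (P : probability T R).
Variables (g : T -> R) (m s : R).
Hypotheses (mg : measurable_fun [set: T] g) (gms : has_normal_law P g m s).

Lemma ge0_intble (f : T -> R) (r : R) : measurable_fun setT f ->
  (forall w, 0 <= f w) -> (\int[P]_w (f w)%:E = r%:E)%E -> intble P f.
Proof.
move=> mf f0 fr; apply/integrableP; split; first exact/measurable_EFinP.
by under eq_integral do rewrite /= ger0_norm //; rewrite fr ltry.
Qed.

Let mexp (c : R) : measurable_fun setT (fun w => expR (c * g w)).
Proof. by apply: measurableT_comp => //; exact: measurable_funM. Qed.

Let iexp c : intble P (fun w => expR (c * g w)).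
Proof.
exact: ge0_intble (integral_exp_normal_law mg gms c).
Qed.

Let Eexp c : \int[P]_w expR (c * g w) = expR (c * m + c ^+ 2 * s ^+ 2 / 2).
Proof. by rewrite /Rintegral (integral_exp_normal_law mg gms). Qed.

(** One term of the exponential series already dominates the power, so exponential moments control
    all the others. *)
Let expR_sym_ge (x : R) k : `|x| ^+ k.+1 <= k.+1`!%:R * (expR x + expR (- x)).
Proof.
have H := expR_ge1Dxn k (normr_ge0 x).
have e : expR `|x| <= expR x + expR (- x).
  by case: (ger0P x) => _; rewrite ?lerDl ?lerDr expR_ge0.
have f0 : 0 < k.+1`!%:R :> R by rewrite ltr0n fact_gt0.
rewrite mulrC -ler_pdivrMr //; apply: le_trans e.
by apply: le_trans H; rewrite lerDr.
Qed.

Lemma normal_intble k : intble P (fun w => g w ^+ k).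
Proof.
case: k => [|k]; first exact: intble_cst.
apply: (@intble_le _ _ _ _ _ (fun w => k.+1`!%:R * (expR (1 * g w) + expR (-1 * g w)))).
- exact: measurable_funX.
- by move=> w; rewrite normrX mul1r mulN1r.
- by apply: intbleZ; apply: intbleD.
Qed.

(* [1 <= E[exp (c g)] = exp (c m + c ^ 2 s ^ 2 / 2)] for every [c]. *)
Lemma normal_mean0 : \int[P]_w g w = 0 -> m = 0.
Proof.
move=> g0.
have H c : 0 <= c * m + c ^+ 2 * s ^+ 2 / 2.
  rewrite -ler_expR expR0 -Eexp.
  have <- : \int[P]_w (1 + c * g w) = 1.
    have ig : intble P g by exact: (normal_intble 1).
    rewrite RintegralD //; last exact: intbleZ.
      by rewrite Rintegral_const RintegralZl // g0 mulr0 addr0.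
    exact: intble_cst.
  apply: Rintegral_le => //; last by move=> w; exact: expR_ge1Dx.
  apply: intbleD; last by apply: intbleZ; exact: (normal_intble 1).
  exact: intble_cst.
have q0 : 0 < s ^+ 2 + 1 by rewrite ltr_wpDl // sqr_ge0.
(* The minimizer [- m / s ^ 2] makes no sense for [s = 0]; with 1 added to the denominator the
   exponent is still negative unless [m = 0]. *)
have := H (- m / (s ^+ 2 + 1)).
have -> : - m / (s ^+ 2 + 1) * m + (- m / (s ^+ 2 + 1)) ^+ 2 * s ^+ 2 / 2 =
  - (m ^+ 2 * ((s ^+ 2 + 2) / (2 * (s ^+ 2 + 1) ^+ 2))).
  by field; rewrite gt_eqF.
rewrite oppr_ge0 pmulr_lle0; last first.
  by rewrite divr_gt0 // ?mulr_gt0 ?exprn_gt0 // ltr_wpDl // sqr_ge0.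
by move=> m2; apply/eqP; rewrite -sqrf_eq0 eq_le m2 sqr_ge0.
Qed.

Hypothesis g0 : \int[P]_w g w = 0.

Let dirac0 k : s = 0 -> \int[P]_w g w ^+ k.+1.*2 = 0.
Proof.
move=> s0; rewrite /Rintegral.
pose f (x : R) := (x ^+ k.+1.*2)%:E.
rewrite -[X in fine X]/(\int[P]_w f (g w))%E (ge0_integral_normal_law mg gms).
- by rewrite s0 eqxx /f /= (normal_mean0 g0) expr0n.
- by apply/measurable_EFinP; exact: measurable_funX.
- by move=> x; rewrite lee_fin exprn_even_ge0 // odd_double.
Qed.

(** [expR_sym_ge] applied to [g / s], a scale at which both exponential moments equal
    [exp (1 / 2)]. *)
Let moment_bound k :
  \int[P]_w g w ^+ k.+1.*2 <= k.+1.*2`!%:R * 2 * expR (1 / 2) * s ^+ k.+1.*2.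
Proof.
have [s0|s0] := eqVneq s 0; first by rewrite dirac0 // s0 expr0n /= mulr0.
have sk : 0 < s ^+ k.+1.*2 by rewrite exprn_even_gt0 ?odd_double.
have H w : g w ^+ k.+1.*2 <=
    k.+1.*2`!%:R * s ^+ k.+1.*2 * (expR (s^-1 * g w) + expR (- s^-1 * g w)).
  have := expR_sym_ge (s^-1 * g w) k.*2.+1.
  rewrite -doubleS -normrX ger0_norm ?exprn_even_ge0 ?odd_double //.
  rewrite exprMn exprVn mulrC ler_pdivrMr // mulNr mulrAC; apply: le_trans.
  by [].
apply: (le_trans (Rintegral_le (normal_intble _) _ H)).
  by apply: intbleZ; apply: intbleD.
rewrite RintegralZl //; last by apply: intbleD.
rewrite (RintegralD measurableT (iexp _) (iexp _)) !Eexp (normal_mean0 g0) !mulr0 !add0r sqrrN.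
rewrite exprVn mulVf ?sqrf_eq0 //.
rewrite le_eqVlt; apply/orP; left; apply/eqP; ring.
Qed.

Lemma normal_moment2_le : \int[P]_w g w ^+ 2 <= 4 * expR (1 / 2) * s ^+ 2.
Proof. by apply: (le_trans (moment_bound 0)); rewrite /= -natrM. Qed.

(** Together with [normal_moment2_le] this makes [s ^ 2] and the variance comparable, which is
    enough to pass from one to the other. It follows from [1 - x <= exp (- x)] and the Gaussian
    integral. *)
Lemma normal_moment2_ge : s ^+ 2 / 3 <= \int[P]_w g w ^+ 2.
Proof.
have [s0|s0] := eqVneq s 0.
  by rewrite s0 expr0n /= mul0r Rintegral_ge0 // => w _; exact: sqr_ge0.
(* Chosen so that [a / (a + s ^ 2) = 1 / 4]: the Gaussian integral is then 1/2, and [1 - E[g ^ 2] /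
   (2 a) <= 1 / 2] is the claim. *)
pose a := s ^+ 2 / 3; have s2 : 0 < s ^+ 2 by rewrite exprn_even_gt0.
have a0 : 0 < a by rewrite divr_gt0.
have E := integral_gauss_normal_law mg gms 0 a0.
have i1 : intble P (fun w => expR (- (g w + 0) ^+ 2 / (2 * a))).
  apply: ge0_intble E => [|w]; last exact: expR_ge0.
  apply: measurableT_comp => //; apply: measurable_funM => //.
  by apply: measurableT_comp => //; apply: measurable_funX; exact: measurable_funD.
have i2 := normal_intble 2.
have i3 : intble P (fun=> 1).
  exact: intble_cst.
have H : \int[P]_w (1 - (2 * a)^-1 * g w ^+ 2) <=
    \int[P]_w expR (- (g w + 0) ^+ 2 / (2 * a)).
  apply: Rintegral_le => // [|w].
    by apply: intbleB => //; exact: intbleZ.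
  by apply: le_trans (expR_ge1Dx _); rewrite addr0 mulNr mulrC.
move: H; rewrite [leRHS]/Rintegral E /= (normal_mean0 g0) addr0 expr0n oppr0 mul0r expR0 mulr1.
have -> : a / (a + s ^+ 2) = (1 / 2) ^+ 2.
  by rewrite /a; field; rewrite ?s0 gt_eqF //; lra.
rewrite sqrtr_sqr ger0_norm ?divr_ge0 //.
rewrite RintegralB //; last exact: intbleZ.
rewrite Rintegral_const RintegralZl // => h.
rewrite -/a; have := ler_wpM2l (ltW a0) h.
rewrite mulrBr mulrA (_ : a * (2 * a)^-1 = 1 / 2); last by field; rewrite gt_eqF.
lra.
Qed.

(** [432 = 48 * 9], with [48 = 4! * 2] from [moment_bound] and 9 from squaring the 3 of
    [normal_moment2_ge]. *)
Lemma normal_moment4_le :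
  \int[P]_w g w ^+ 4 <= 432 * expR (1 / 2) * (\int[P]_w g w ^+ 2) ^+ 2.
Proof.
apply: (le_trans (moment_bound 1)); rewrite -!natrM /=.
have h := normal_moment2_ge.
have : (s ^+ 2 / 3) ^+ 2 <= (\int[P]_w g w ^+ 2) ^+ 2.
  by apply: lerXn2r; rewrite ?nnegrE // ?divr_ge0 ?sqr_ge0 // (le_trans _ h) // divr_ge0 ?sqr_ge0.
move=> h2; have e0 := mulr_ge0 (ler0n R 432) (expR_ge0 (1 / 2 : R)).
have := ler_wpM2l e0 h2; apply: le_trans.
rewrite le_eqVlt; apply/orP; left; apply/eqP.
by rewrite (_ : (_ * 2)%:R = 48) //; field.
Qed.

End normal_moments.

(** * Anticoncentration of sums of independent normal variables *)

Section anticoncentration.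
Context (R : realType) d (T : measurableType d) (P : probability T R) (n : nat).
Variables (g : 'I_n -> T -> R) (m s : 'I_n -> R).
Hypotheses (mg : forall j, measurable_fun [set: T] (g j)).
Hypotheses (gms : forall j, has_normal_law P (g j) (m j) (s j)).
Hypothesis indg : forall j : 'I_n,
  independent_pair P (fun w => \sum_(i < n | (i < j)%N) g i w) (g j).

(* Averaging a Gaussian bump of variance [a] over a Gaussian of variance [s ^ 2]
   yields one of variance [a + s ^ 2]; the lemma iterates this, so that the law
   of the sum is never computed. *)
Let partial_anticoncentration (k : nat) (a c : R) : (k <= n)%N -> 0 < a ->
  (\int[P]_w (expR (- (\sum_(j < n | (j < k)%N) g j w + c) ^+ 2 / (2 * a)))%:E
   <= (Num.sqrt (a / (a + \sum_(j < n | (j < k)%N) s j ^+ 2)))%:E)%E.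
Proof.
elim: k a c => [|k IH] a c kn a0.
  under eq_integral do rewrite big_pred0 //.
  rewrite big_pred0 // addr0 divff ?gt_eqF // sqrtr1 integral_cst //.
  rewrite [X in (_ * X)%E](_ : _ = 1%E); last exact: probability_setT.
  rewrite mule1 lee_fin add0r -expR0 ler_expR.
  by rewrite mulNr oppr_le0 divr_ge0 ?sqr_ge0 // mulr_ge0 // ltW.
pose j := Ordinal kn; have kn' := ltnW kn.
have split (F : 'I_n -> R) :
    \sum_(i < n | (i < k.+1)%N) F i = F j + \sum_(i < n | (i < k)%N) F i.
  rewrite (bigD1 j) //=; congr (_ + _); apply: eq_bigl => i.
  by rewrite ltnS leq_eqVlt -val_eqE /=; case: ltngtP.
pose W w := \sum_(i < n | (i < k)%N) g i w.
have mW : measurable_fun setT W.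
  rewrite /W; under [X in measurable_fun _ X]eq_fun do rewrite big_mkcond.
  by apply: measurable_sum => i; case: (i < k)%N.
have ind : independent_pair P (g j) W.
  by move=> A B mA mB; rewrite setIC muleC; exact: (indg j).
pose F (z : R * R) : \bar R := (expR (- (z.1 + (z.2 + c)) ^+ 2 / (2 * a)))%:E.
have mF : measurable_fun setT F.
  apply/measurable_EFinP/measurableT_comp => //; apply: measurable_funM => //.
  apply: measurableT_comp => //; apply: measurable_funX.
  by apply: measurable_funD => //; exact: measurable_funD.
have s2 : 0 <= s j ^+ 2 by exact: sqr_ge0.
have as0 : 0 < a + s j ^+ 2 by rewrite ltr_wpDr.
have S0 : 0 <= \sum_(i < n | (i < k)%N) s i ^+ 2.
  by apply: sumr_ge0 => i _; exact: sqr_ge0.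
under eq_integral do rewrite split -addrA.
rewrite -[leLHS]/(\int[P]_w F (g j w, W w))%E.
rewrite (independent_pair_ge0_integral (mg j) mW ind mF); last first.
  by move=> z; rewrite lee_fin expR_ge0.
(* Integrating out [g j] turns [a] into [a + s j ^ 2] and [c] into [m j + c], hence the induction is
   over all [a] and [c]. The resulting product of square roots telescopes. *)
under eq_integral => v _.
  rewrite /F /= (integral_gauss_normal_law (mg j) (gms j)) // EFinM.
  rewrite (_ : m j + (W v + c) = W v + (m j + c)); last by ring.
  over.
rewrite /= ge0_integralZl //; last first.
  apply/measurable_EFinP/measurableT_comp => //; apply: measurable_funM => //.
  apply: measurableT_comp => //; apply: measurable_funX.
  exact: measurable_funD.
apply: (le_trans (lee_wpmul2l _ (IH _ (m j + c) kn' as0))).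
  by rewrite lee_fin sqrtr_ge0.
rewrite -EFinM lee_fin -sqrtrM; last by rewrite divr_ge0 // ltW.
rewrite split le_eqVlt; apply/orP; left; apply/eqP; congr Num.sqrt.
by field; rewrite !gt_eqF //; lra.
Qed.

Lemma normal_sum_anticoncentration (a c : R) : 0 < a ->
  (\int[P]_w (expR (- (\sum_j g j w + c) ^+ 2 / (2 * a)))%:E <=
    (Num.sqrt (a / (a + \sum_j s j ^+ 2)))%:E)%E.
Proof.
move=> a0.
have ordlt (F : 'I_n -> R) : \sum_j F j = \sum_(j < n | (j < n)%N) F j.
  by apply: eq_bigl => j; rewrite ltn_ord.
by rewrite ordlt; under eq_integral do rewrite ordlt; exact: partial_anticoncentration.
Qed.

End anticoncentration.

(** * Comparison on one probability space *)

Section orthants.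
Context (R : realType) (m : nat).
Local Notation vec := 'rV[R]_m.

Lemma orthant_union_indic (A : set vec) :
  translate_of_union_of_orthants A -> exists (theta : vec)
    (chi : ('I_m -> bool) -> R), (forall s, 0 <= chi s <= 1) /\
    forall x, \1_A x = chi (fun i => theta 0 i <= x 0 i).
Proof.
move=> [theta hA]; exists theta.
(* [chi s] reads membership off one representative of the orthant with pattern [s], at distance 1
   from [theta] in every coordinate. *)
exists (fun s => \1_A (theta + \row_i (if s i then 1 else -1))); split.
  by move=> s; rewrite indicE; case: (_ \in _); rewrite ?lexx ?ler01.
move=> x; rewrite !indicE; congr (_%:R); congr nat_of_bool.
have E : vsgn (x - theta) = vsgn
    (theta + \row_i (if theta 0 i <= x 0 i then 1 else -1) - theta).
  apply/rowP => i; rewrite /vsgn !mxE /sgn subr_ge0.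
  set t := (if _ then _ else _ : R).
  rewrite (_ : theta 0 i + t - theta 0 i = t); last by ring.
  by rewrite /t; case: ifP => _; rewrite ?ler01 ?oppr_ge0 ?ler10.
by apply/idP/idP; rewrite !inE; apply hA.
Qed.

Lemma smoothing_measurable (p : 'I_m -> R -> R) l chi s :
  (forall i, measurable_fun setT (p i)) -> coord_measurable (smoothing p l chi s).
Proof.
move=> mp; elim: l s => [|i l IH] s dO O V mV /=; first exact: measurable_cst.
have mpi : measurable_fun setT (fun w => p i (V w 0 i)).
  exact: (measurableT_comp (mp i) (mV i)).
apply: measurable_funD; apply: measurable_funM => //; try exact: IH.
exact: measurable_funB.
Qed.

Lemma orthant_union_measurable (A : set vec) :
  translate_of_union_of_orthants A -> coord_measurable (\1_A : vec -> R).
Proof.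
move=> /orthant_union_indic[theta [chi [_ hA]]].
(* The indicator is its own smoothing by sharp steps. *)
pose p (i : 'I_m) (t : R) : R := (theta 0 i <= t)%R%:R.
have mp i : measurable_fun setT (p i).
  rewrite (_ : p i = \1_(`[theta 0 i, +oo[)); first exact: measurable_indic.
  by apply/funext => t; rewrite indicE mem_setE in_itv /= andbT.
have -> : (\1_A : vec -> R) = smoothing p (enum 'I_m) chi (fun=> true).
  apply/funext => x; rewrite (smoothing_eq _ _ (e := fun i => theta 0 i <= x 0 i)) //.
  by rewrite hA; congr chi; apply/funext => i; rewrite mem_enum.
exact: smoothing_measurable.
Qed.

(** A rising step over [[c - 5 l, c - 2 l]] times a falling one over [[c + 2 l, c + 5 l]]. The terms
    multiplied by 0 and 1 are kept so that it is literally a mixture of a mixture and [smooth3_mix]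
    applies. *)
Definition plateau (l c : R) (i : 'I_m) (x : vec) : R :=
  spline ((x 0 i - (c - 5 * l)) / l) *
    (spline ((x 0 i - (c + 2 * l)) / l) * 0
     + (1 - spline ((x 0 i - (c + 2 * l)) / l)) * 1)
  + (1 - spline ((x 0 i - (c - 5 * l)) / l)) * 0.

(** The increment size that two mixings along [i] produce from constants. *)
Definition plateau_size (i : 'I_m) (y : vec) : R := 0 + `|y 0 i| + `|y 0 i|.

Lemma smooth3_plateau l c i : 0 < l -> smooth3 (3 / l) (plateau_size i) (plateau l c i).
Proof.
move=> l0; have k0 : 0 <= 3 / l by rewrite divr_ge0 // ltW.
apply: (smooth3_mix i k0 (smooth_step_scale _ l0 (smooth_step_spline R))).
  apply: (smooth3_mix i k0 (smooth_step_scale _ l0 (smooth_step_spline R)));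
    by apply: smooth3_cst; rewrite ?lexx ?ler01.
by apply: smooth3_cst; rewrite ?lexx ?ler01 // => y; rewrite add0r.
Qed.

Lemma plateau_eq1 l c i (x : vec) : 0 < l -> c - l <= x 0 i -> x 0 i <= c + 2 * l ->
  plateau l c i x = 1.
Proof.
move=> l0 x1 x2; rewrite /plateau spline_ge3; last by rewrite ler_pdivlMr //; lra.
rewrite spline_le0; last by rewrite pmulr_lle0 ?invr_gt0 //; lra.
by ring.
Qed.

(** The plateau vanishes at distance [5 l] or more from [c]; nearer to [c], a Gaussian bump of
    variance [(5 l) ^ 2] is at least [exp (- 1 / 2)]. *)
Lemma plateau_le_gauss l c i (x : vec) : 0 < l ->
  plateau l c i x <= expR (1 / 2) * expR (- (x 0 i - c) ^+ 2 / (2 * (5 * l) ^+ 2)).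
Proof.
move=> l0; have [a [b H]] := smooth3_plateau c i l0.
have le1 := taylor_le1 H x; have ge0 := taylor_ge0 H x.
have [out|] := boolP ((x 0 i <= c - 5 * l) || (c + 5 * l <= x 0 i)).
  rewrite (_ : plateau l c i x = 0) ?mulr_ge0 ?expR_ge0 //.
  rewrite /plateau; case/orP: out => h.
    by rewrite spline_le0 ?pmulr_lle0 ?invr_gt0 //; [ring|lra].
  rewrite (@spline_ge3 _ ((x 0 i - (c + 2 * l)) / l)); first by ring.
  by rewrite ler_pdivlMr //; lra.
rewrite negb_or -!ltNge => /andP[h1 h2]; apply: (le_trans le1).
rewrite -expRD -[leLHS]expR0 ler_expR mulNr subr_ge0 ler_pdivrMr; last first.
  by rewrite mulr_gt0 // exprn_gt0 // mulr_gt0.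
have h : (x 0 i - c) ^+ 2 <= (5 * l) ^+ 2.
  by rewrite -subr_ge0 subr_sqr mulr_ge0 //; lra.
by rewrite mulrA (_ : 1 / 2 * 2 = 1) ?mul1r //; field.
Qed.

(** If some coordinate lies in its window [[theta_i - l, theta_i + 2 l]], its plateau is 1, which
    bounds the distance of two numbers in [[0, 1]]. Otherwise every step is 0 or 1 and the smoothing
    is exact. *)
Lemma smoothing_orthant_approx (A : set vec) (theta : vec)
    (chi : ('I_m -> bool) -> R) (l : R) (x : vec) : 0 < l ->
  (forall s, 0 <= chi s <= 1) ->
  \1_A x = chi (fun i => theta 0 i <= x 0 i) ->
  `|\1_A x - smoothing (fun i t => spline ((t - (theta 0 i - l)) / l))
               (enum 'I_m) chi (fun=> true) x|
  <= \sum_i plateau l (theta 0 i) i x.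
Proof.
move=> l0 chi01 hA.
pose p (i : 'I_m) (t : R) := spline ((t - (theta 0 i - l)) / l).
have b0 i : 0 <= plateau l (theta 0 i) i x.
  by have [a [b H]] := smooth3_plateau (theta 0 i) i l0; exact: (taylor_ge0 H).
have [/existsP[i hi]|] := boolP [exists i, (theta 0 i - l <= x 0 i <= theta 0 i + 2 * l)].
  have k0 : 0 <= 3 / l by rewrite divr_ge0 // ltW.
  have [a [b H]] := smooth3_smoothing k0
    (fun i => smooth_step_scale (theta 0 i - l) l0 (smooth_step_spline R))
    (enum 'I_m) (fun=> true) chi01.
  have h1 := taylor_le1 H x; have h0 := taylor_ge0 H x.
  rewrite (bigD1 i) //= plateau_eq1 //; try by case/andP: hi.
  have : 0 <= \sum_(j | j != i) plateau l (theta 0 j) j x by exact: sumr_ge0.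
  move=> hs; apply: (@le_trans _ _ 1); last by rewrite lerDl.
  have /andP[c0 c1] := chi01 (fun i => theta 0 i <= x 0 i).
  by rewrite hA ler_norml; move: c0 c1 h0 h1; lra.
rewrite negb_exists => /forallP H.
rewrite (smoothing_eq _ _ (e := fun i => theta 0 i <= x 0 i)).
  rewrite hA (_ : chi _ = chi (fun i => theta 0 i <= x 0 i)).
    by rewrite subrr normr0 sumr_ge0.
  by congr chi; apply/funext => i; rewrite mem_enum.
move=> i _; have := H i; rewrite negb_and -!ltNge => /orP[h|h].
  rewrite spline_le0; last by rewrite pmulr_lle0 ?invr_gt0 //; lra.
  by rewrite (_ : (theta 0 i <= x 0 i) = false) //; apply/negbTE; rewrite -ltNge; lra.
rewrite spline_ge3; last by rewrite ler_pdivlMr //; lra.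
by rewrite (_ : (theta 0 i <= x 0 i) = true) //; lra.
Qed.

End orthants.

(** * Invariance for unions of orthants *)

Section invariance.
Context (R : realType) d (T : measurableType d) (P : probability T R) (m n : nat).
Local Notation vec := 'rV[R]_m.

Lemma measurable_preimage_indic (A : set vec) (V : T -> vec) :
  measurable_fun setT (fun w => \1_A (V w) : R) -> measurable (V @^-1` A).
Proof.
move=> mA; rewrite (_ : V @^-1` A = (fun w => \1_A (V w) : R) @^-1` [set 1]).
  by rewrite -[X in measurable X]setTI; exact: mA.
apply/seteqP; split => w /=; rewrite indicE.
  by move=> /mem_set ->.
by case: (boolP (V w \in A)) => [/set_mem//|_ /esym/eqP]; rewrite oner_eq0.
Qed.

Lemma Rintegral_indic_comp (A : set vec) (V : T -> vec) :
  measurable_fun setT (fun w => \1_A (V w) : R) ->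
  \int[P]_w \1_A (V w) = fine (P (V @^-1` A)).
Proof.
move=> /measurable_preimage_indic mVA.
by rewrite -[in RHS](setIT (V @^-1` A)) -integral_indic.
Qed.

Variable Z : bool * 'I_n -> T -> vec.
Hypothesis mZ : forall i, measurable_fun setT (Z i).
Hypothesis indZ : independent_family P Z.
Hypothesis iZ1 : forall i a, intble P (fun w => Z i w 0 a).
Hypothesis iZ2 : forall i a b, intble P (fun w => Z i w 0 a * Z i w 0 b).
Hypothesis eZ1 : forall j a,
  \int[P]_w Z (true, j) w 0 a = \int[P]_w Z (false, j) w 0 a.
Hypothesis eZ2 : forall j a b,
  \int[P]_w (Z (true, j) w 0 a * Z (true, j) w 0 b) =
  \int[P]_w (Z (false, j) w 0 a * Z (false, j) w 0 b).

Definition l1norm (y : vec) : R := \sum_i `|y 0 i|.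

Hypothesis iZ3 : forall i, intble P (fun w => l1norm (Z i w) ^+ 3).

Let third_moments := \sum_j (\int[P]_w l1norm (Z (true, j) w) ^+ 3
                      + \int[P]_w l1norm (Z (false, j) w) ^+ 3).

Let sumZ b w := \sum_j Z (b, j) w.

Let mcoordZ i a : measurable_fun setT (fun w => Z i w 0 a).
Proof. exact: (measurableT_comp (measurable_coord a) (mZ i)). Qed.

Let msumZ b a : measurable_fun setT (fun w => sumZ b w 0 a).
Proof.
under [X in measurable_fun _ X]eq_fun do rewrite /sumZ summxE.
by apply: measurable_sum => j; exact: mcoordZ.
Qed.

Let coord_le (y : vec) i : `|y 0 i| <= l1norm y.
Proof. by rewrite /l1norm (bigD1 i) //= lerDl sumr_ge0. Qed.

Let icoord3 i a : intble P (fun w => `|Z i w 0 a| ^+ 3).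
Proof.
apply: (intble_le _ _ (iZ3 i)).
  by apply: measurable_funX; exact: measurableT_comp.
move=> w; rewrite normrX normr_id; apply: lerXn2r; rewrite ?nnegrE ?coord_le //.
by apply: sumr_ge0.
Qed.

(** Thanks to this, replacement in all the plateaus together costs no more, up to a constant, than
    replacement in the one smoothed indicator. *)
Let coord_cubes i :
  \sum_a \int[P]_w `|Z i w 0 a| ^+ 3 <= \int[P]_w l1norm (Z i w) ^+ 3.
Proof.
rewrite -Rintegral_sum //; apply: Rintegral_le => //; first exact: intble_sum.
move=> w; rewrite (exprS (l1norm _)) {1}/l1norm mulr_suml.
apply: ler_sum => a _; rewrite exprS ler_wpM2l //.
by apply: lerXn2r; rewrite ?nnegrE ?coord_le // sumr_ge0.
Qed.

(** [9 = 1 + 8]: the replacement cost of the smoothed indicator, plus that of moving the plateaus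
    from the [true] sum to the [false] one, where [plateau_size] cubed gives [2 ^ 3]. After this
    move both smoothing errors are plateaus of the [false] sum, whence the factor 2. *)
Lemma orthant_invariance (A : set vec) (theta : vec)
    (chi : ('I_m -> bool) -> R) (l : R) : 0 < l ->
  coord_measurable (\1_A : vec -> R) ->
  (forall s, 0 <= chi s <= 1) ->
  (forall x, \1_A x = chi (fun i => theta 0 i <= x 0 i)) ->
  `| fine (P (sumZ true @^-1` A)) - fine (P (sumZ false @^-1` A)) |
  <= 9 * (3 / l) ^+ 3 * third_moments
     + 2 * \sum_i \int[P]_w plateau l (theta 0 i) i (sumZ false w).
Proof.
move=> l0 mA chi01 hA.
have k0 : 0 <= 3 / l by rewrite divr_ge0 // ltW.
have k3 : 0 <= (3 / l) ^+ 3 by exact: exprn_ge0.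
rewrite -!Rintegral_indic_comp; try exact: mA.
set Psi := smoothing (fun i t => spline ((t - (theta 0 i - l)) / l))
               (enum 'I_m) chi (fun=> true).
have S : smooth3 (3 / l) l1norm Psi.
  rewrite (_ : l1norm = (fun y => \sum_(i <- enum 'I_m) `|y 0 i|)).
    exact: (smooth3_smoothing k0
      (fun i => smooth_step_scale (theta 0 i - l) l0 (smooth_step_spline R))).
  by apply/funext => y; rewrite big_enum.
have ib f N b : smooth3 (3 / l) N f -> intble P (fun w => f (sumZ b w)).
  move=> [a' [b' H]]; apply: (@intble_bounded _ _ _ _ _ 1).
    exact: (taylor_meas H).
  by move=> w; rewrite ger0_norm ?(taylor_ge0 H) ?(taylor_le1 H).
have iA b : intble P (fun w => \1_A (sumZ b w)).
  apply: (@intble_bounded _ _ _ _ _ 1); first exact: mA.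
  by move=> w; rewrite indicE; case: (_ \in _); rewrite ?normr1 ?normr0.
have iB b i : intble P (fun w => plateau l (theta 0 i) i (sumZ b w)).
  exact: (ib _ _ _ (smooth3_plateau _ _ l0)).
have psiA b : `| \int[P]_w \1_A (sumZ b w) - \int[P]_w Psi (sumZ b w) | <=
    \sum_i \int[P]_w plateau l (theta 0 i) i (sumZ b w).
  rewrite -RintegralB //; [|exact: iA|exact: (ib _ _ _ S)].
  have iD : intble P (fun w => \1_A (sumZ b w) - Psi (sumZ b w)).
    by apply: intbleB => //; exact: (ib _ _ _ S).
  apply: (le_trans (le_normr_Rintegral measurableT iD)).
  rewrite -Rintegral_sum; last by move=> i; exact: iB.
  apply: le_Rintegral => //.
  - exact: integrable_norm.
  - by apply: intble_sum => i; exact: iB.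
  - by move=> w _; exact: smoothing_orthant_approx.
have inv := lindeberg mZ indZ iZ1 iZ2 eZ1 eZ2 k0 S iZ3.
have invb i : \int[P]_w plateau l (theta 0 i) i (sumZ true w) <=
    \int[P]_w plateau l (theta 0 i) i (sumZ false w) + 8 * (3 / l) ^+ 3 *
     \sum_j (\int[P]_w `|Z (true, j) w 0 i| ^+ 3
                      + \int[P]_w `|Z (false, j) w 0 i| ^+ 3).
  have E z : plateau_size i z ^+ 3 = 8 * `|z 0 i| ^+ 3 by rewrite /plateau_size; ring.
  have iN i' : intble P (fun w => plateau_size i (Z i' w) ^+ 3).
    by under [X in intble _ X]eq_fun do rewrite E; exact: intbleZ.
  have := lindeberg mZ indZ iZ1 iZ2 eZ1 eZ2 k0 (smooth3_plateau (theta 0 i) i l0) iN.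
  move=> /(le_trans (ler_norm _)); rewrite lerBlDl => h; apply: (le_trans h).
  rewrite lerD2l -mulrA mulrCA ler_wpM2l // mulr_sumr; apply: ler_sum => j _.
  have E' b : \int[P]_w plateau_size i (Z (b, j) w) ^+ 3 = 8 * \int[P]_w `|Z (b, j) w 0 i| ^+ 3.
    by rewrite -RintegralZl //; [apply: eq_Rintegral => w _; exact: E|exact: icoord3].
  by rewrite !E' mulrDr.
have sums : \sum_i \int[P]_w plateau l (theta 0 i) i (sumZ true w) <=
    \sum_i \int[P]_w plateau l (theta 0 i) i (sumZ false w)
    + 8 * (3 / l) ^+ 3 * third_moments.
  apply: (le_trans (ler_sum _ (fun i _ => invb i))).
  rewrite big_split /= lerD2l -mulr_sumr; apply: ler_wpM2l; first by rewrite mulr_ge0.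
  rewrite exchange_big /=.
  by apply: ler_sum => j _; rewrite big_split /= lerD.
have aT := psiA true; have aF := psiA false.
rewrite -/(third_moments) in inv.
rewrite (_ : _ - _ = (\int[P]_w \1_A (sumZ true w) - \int[P]_w Psi (sumZ true w))
  + (\int[P]_w Psi (sumZ true w) - \int[P]_w Psi (sumZ false w))
  - (\int[P]_w \1_A (sumZ false w) - \int[P]_w Psi (sumZ false w))); last by ring.
apply: (le_trans (ler_normB _ _)).
apply: (le_trans (lerD (ler_normD _ _) aF)).
apply: (le_trans (lerD (lerD aT inv) (lexx _))).
move: sums; set K := (3 / l) ^+ 3; set B1 := \sum_i \int[P]_w plateau _ _ _ (sumZ true w).
set B2 := \sum_i \int[P]_w plateau _ _ _ (sumZ false w).
by lra.
Qed.

End invariance.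

(** * Moments *)

Section transport.
Context (R : realType) d (T : measurableType d) (P : probability T R).
Context d' (T' : measurableType d') (P' : probability T' R).
Variable phi : T' -> T.
Hypothesis mphi : measurable_fun setT phi.
Hypothesis phiP : forall A, measurable A -> P' (phi @^-1` A) = P A.

Let phiM : {mfun T' >-> T} := mfun_Sub (mem_set mphi : phi \in mfun).

Lemma ge0_integral_transport (f : T -> \bar R) : measurable_fun setT f ->
  (forall x, 0 <= f x)%E -> (\int[P']_w f (phi w) = \int[P]_w f w)%E.
Proof.
move=> mf f0; transitivity (\int[distribution P' phiM]_x f x)%E.
  by rewrite ge0_integral_distribution.
by apply: eq_measure_integral => A mA _; exact: phiP.
Qed.

Lemma intble_transport (f : T -> R) : intble P f -> intble P' (fun w => f (phi w)).
Proof.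
move=> /integrableP[mf fi]; apply/integrableP; split.
  exact: (measurableT_comp mf).
rewrite (@ge0_integral_transport (fun w => `|(f w)%:E|)%E) //.
exact: measurableT_comp.
Qed.

Lemma Rintegral_transport (f : T -> R) : intble P f ->
  \int[P']_w f (phi w) = \int[P]_w f w.
Proof.
move=> fi; have mf : measurable_fun setT (EFin \o f).
  by apply/measurable_EFinP; exact: intble_meas fi.
rewrite /Rintegral; congr fine.
transitivity (\int[distribution P' phiM]_x (f x)%:E)%E.
  by rewrite integral_pushforward //; exact: intble_transport.
by apply: eq_measure_integral => A mA _; exact: phiP.
Qed.

End transport.

(** * Third moments from second and fourth moments *)

Section vector_moments.
Context (R : realType) d (T : measurableType d) (P : probability T R) (m : nat).
Local Notation vec := 'rV[R]_m.

Definition sqnorm (x : vec) : R := \sum_i x 0 i ^+ 2.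

Lemma sqnorm_ge0 x : 0 <= sqnorm x.
Proof. by apply: sumr_ge0 => i _; exact: sqr_ge0. Qed.

Lemma eucl_norm_sqr x : eucl_norm x ^+ 2 = sqnorm x.
Proof. by rewrite /eucl_norm sqr_sqrtr //; exact: sqnorm_ge0. Qed.

Lemma l1norm_ge0 (x : vec) : 0 <= l1norm x.
Proof. exact: sumr_ge0. Qed.

(** Cauchy-Schwarz against the constant vector, by expanding the sum of all [(F i - F j) ^ 2]. *)
Lemma sqr_sum_le (F : 'I_m -> R) :
  (\sum_i F i) ^+ 2 <= m%:R * \sum_i F i ^+ 2.
Proof.
have H : 0 <= \sum_i \sum_j (F i - F j) ^+ 2.
  by apply: sumr_ge0 => i _; apply: sumr_ge0 => j _; exact: sqr_ge0.
have E : \sum_i \sum_j (F i - F j) ^+ 2 =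
    2 * (m%:R * \sum_i F i ^+ 2) - 2 * (\sum_i F i) ^+ 2.
  transitivity (\sum_i \sum_j (F i ^+ 2 + F j ^+ 2 + - 2 * (F i * F j))).
    by apply: eq_bigr => i _; apply: eq_bigr => j _; ring.
  under eq_bigr do rewrite !big_split /= sumr_const card_ord -!mulr_sumr.
  rewrite !big_split /= sumr_const card_ord sumrMnl -mulr_sumr -mulr_suml.
  rewrite -!(mulr_natl (\sum_i F i ^+ 2)).
  by move: (\sum_i F i ^+ 2) (\sum_i F i) (m%:R : R) => u v c; ring.
by move: H; rewrite E; lra.
Qed.

Lemma l1norm_sqr_le (x : vec) : l1norm x ^+ 2 <= m%:R * sqnorm x.
Proof.
apply: (le_trans (sqr_sum_le _)); rewrite ler_wpM2l //; apply: ler_sum => i _.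
by rewrite real_normK // num_real.
Qed.

Variable V : T -> vec.
Hypothesis mV : forall i, measurable_fun setT (fun w => V w 0 i).

Lemma measurable_sqnorm : measurable_fun setT (fun w => sqnorm (V w)).
Proof. by apply: measurable_sum => i; exact: measurable_funX. Qed.

Lemma measurable_l1norm : measurable_fun setT (fun w => l1norm (V w)).
Proof. by apply: measurable_sum => i; exact: measurableT_comp. Qed.

Hypothesis iV : intble P (fun w => sqnorm (V w) ^+ 2).

Lemma intble_sqnorm : intble P (fun w => sqnorm (V w)).
Proof.
apply: (intble_le _ _ (intbleD (intble_cst P 1) iV)); first exact: measurable_sqnorm.
move=> w; rewrite ger0_norm ?sqnorm_ge0 //.
have := sqr_ge0 (sqnorm (V w) - 1 / 2); lra.
Qed.

Let coord_sqr w i : V w 0 i ^+ 2 <= sqnorm (V w).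
Proof.
by rewrite /sqnorm (bigD1 i) //= lerDl sumr_ge0 // => j _; exact: sqr_ge0.
Qed.

Lemma intble_coordM i j : intble P (fun w => V w 0 i * V w 0 j).
Proof.
apply: (intble_le _ _ intble_sqnorm); first exact: measurable_funM.
move=> w; have := coord_sqr w i; have := coord_sqr w j.
have := sqr_ge0 (V w 0 i - V w 0 j); have := sqr_ge0 (V w 0 i + V w 0 j).
by rewrite ler_norml; lra.
Qed.

Lemma intble_coord i : intble P (fun w => V w 0 i).
Proof.
apply: (intble_le _ _ (intbleD (intble_cst P 1) intble_sqnorm)) => // w.
have := coord_sqr w i.
have := sqr_ge0 (V w 0 i - 1); have := sqr_ge0 (V w 0 i + 1).
by have := sqnorm_ge0 (V w); rewrite ler_norml; lra.
Qed.

(** The bound is linear in [sqnorm] and its square, so it can be integrated and summed over the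
    vectors with a single weight [a], to be fixed at the end. *)
Let cube_le (a : R) w : 0 < a -> l1norm (V w) ^+ 3 <=
  m%:R / (2 * a) * sqnorm (V w) + a * m%:R ^+ 2 / 2 * sqnorm (V w) ^+ 2.
Proof.
move=> a0; have h := l1norm_sqr_le (V w).
have h2 : l1norm (V w) ^+ 4 <= (m%:R * sqnorm (V w)) ^+ 2.
  rewrite (_ : l1norm (V w) ^+ 4 = (l1norm (V w) ^+ 2) ^+ 2); last by ring.
  by apply: lerXn2r => //; rewrite nnegrE ?sqr_ge0 // (le_trans _ h) ?sqr_ge0.
move: h h2; set N := l1norm _; set q := sqnorm _ => h h2.
have : 0 <= N ^+ 2 * (1 - a * N) ^+ 2 / (2 * a).
  by apply: divr_ge0; apply: mulr_ge0; rewrite ?sqr_ge0 // ltW.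
have -> : N ^+ 2 * (1 - a * N) ^+ 2 / (2 * a) =
    N ^+ 2 / (2 * a) - N ^+ 3 + a / 2 * N ^+ 4 by field; rewrite gt_eqF.
have p1 : N ^+ 2 / (2 * a) <= m%:R * q / (2 * a).
  by rewrite ler_pM2r // invr_gt0 mulr_gt0.
have p2 : a / 2 * N ^+ 4 <= a / 2 * (m%:R * q) ^+ 2.
  by rewrite ler_wpM2l // divr_ge0 // ltW.
rewrite (_ : m%:R / (2 * a) * q = m%:R * q / (2 * a)); last by ring.
rewrite (_ : a * m%:R ^+ 2 / 2 * q ^+ 2 = a / 2 * (m%:R * q) ^+ 2); last by ring.
by lra.
Qed.

Let intble_dominant a : intble P (fun w =>
  m%:R / (2 * a) * sqnorm (V w) + a * m%:R ^+ 2 / 2 * sqnorm (V w) ^+ 2).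
Proof. by apply: intbleD; apply: intbleZ => //; exact: intble_sqnorm. Qed.

Lemma intble_l1norm3 : intble P (fun w => l1norm (V w) ^+ 3).
Proof.
apply: (intble_le _ _ (intble_dominant 1)).
  by apply: measurable_funX; exact: measurable_l1norm.
by move=> w; rewrite ger0_norm ?exprn_ge0 ?l1norm_ge0 // cube_le.
Qed.

(* By AM-GM, [N ^ 3 <= (N ^ 2 / a + a N ^ 4) / 2]. *)
Lemma l1norm3_le (a K s2 : R) : 0 < a ->
  \int[P]_w sqnorm (V w) = s2 -> \int[P]_w sqnorm (V w) ^+ 2 <= K * s2 ^+ 2 ->
  \int[P]_w l1norm (V w) ^+ 3 <=
    m%:R / (2 * a) * s2 + a * m%:R ^+ 2 / 2 * (K * s2 ^+ 2).
Proof.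
move=> a0 e2 e4.
apply: (le_trans (Rintegral_le intble_l1norm3 (intble_dominant a)
  (fun w => cube_le w a0))).
rewrite RintegralD //; try by apply: intbleZ => //; exact: intble_sqnorm.
rewrite RintegralZl //; last exact: intble_sqnorm.
rewrite RintegralZl // e2 lerD2l ler_wpM2l // divr_ge0 // mulr_ge0 ?sqr_ge0 //.
exact: ltW.
Qed.

End vector_moments.

(** * Moments of hypercontractive vectors *)

Section hypercontractive_moments.
Context (R : realType) d (T : measurableType d) (P : probability T R) (m : nat).
Local Notation vec := 'rV[R]_m.
Variable X : T -> vec.
Hypothesis mX : forall i, measurable_fun setT (fun w => X w 0 i).

Lemma eucl_normZ (c : R) (x : vec) : 0 <= c -> eucl_norm (c *: x) = c * eucl_norm x.
Proof.
move=> c0; rewrite /eucl_norm -{2}(ger0_norm c0) -sqrtr_sqr -sqrtrM ?sqr_ge0 //.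
by congr Num.sqrt; rewrite mulr_sumr; apply: eq_bigr => i _; rewrite mxE exprMn.
Qed.

Lemma vec_Lnorm_pow k (Y : T -> vec) :
  (vec_Lnorm P k.+1%:R Y `^ k.+1%:R = \int[P]_w (eucl_norm (Y w) ^+ k.+1)%:E)%E.
Proof.
rewrite /vec_Lnorm poweR_Lnorm ?pnatr_eq0 //; apply: eq_integral => w _.
by rewrite /= powR_mulrn // ger0_norm // sqrtr_ge0.
Qed.

Variable eta : R.
Hypotheses (eta0 : 0 < eta) (hX : HC P eta X).

Lemma HC_intble : intble P (fun w => sqnorm (X w) ^+ 2).
Proof.
apply/integrableP; split.
  by apply/measurable_EFinP; apply: measurable_funX; exact: measurable_sqnorm.
have [fin _] := hX.
rewrite [ltLHS](_ : _ = \int[P]_w (eucl_norm (X w) ^+ 4)%:E)%E.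
  by rewrite -vec_Lnorm_pow poweR_lty.
apply: eq_integral => w _ /=; congr EFin.
by rewrite -eucl_norm_sqr -exprM ger0_norm // exprn_ge0 // sqrtr_ge0.
Qed.

Lemma HC_moment4 : \int[P]_w sqnorm (X w) ^+ 2 <=
  eta ^- 4 * (\int[P]_w sqnorm (X w)) ^+ 2.
Proof.
have i4 := HC_intble; have i2 := intble_sqnorm mX i4.
(* At the shift 0, hypercontractivity compares the fourth-order norm of [eta X] with the
   second-order norm of [X]; fourth powers then give moments. *)
have [_ /(_ 0) H] := hX.
have f2 : (\int[P]_w (sqnorm (X w))%:E)%E \is a fin_num by apply: integrable_fin_num.
have f4 : (\int[P]_w (sqnorm (X w) ^+ 2)%:E)%E \is a fin_num by apply: integrable_fin_num.
have h : (vec_Lnorm P 4 (fun w => 0 + eta *: X w)%R `^ 4 <=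
          vec_Lnorm P 2 (fun w => 0 + X w)%R `^ 4)%E.
  by apply: gt0_ler_poweR => //; rewrite in_itv /= leey andbT; exact: Lnorm_ge0.
move: h; rewrite (vec_Lnorm_pow 3).
rewrite (_ : 4 = 2 * 2 :> R); last by ring.
rewrite poweRrM (vec_Lnorm_pow 1).
have -> : (\int[P]_w (eucl_norm (0 + X w) ^+ 2)%:E = \int[P]_w (sqnorm (X w))%:E)%E.
  by apply: eq_integral => w _; rewrite add0r eucl_norm_sqr.
have -> : (\int[P]_w (eucl_norm (0 + eta *: X w) ^+ 4)%:E =
    (eta ^+ 4)%:E * \int[P]_w (sqnorm (X w) ^+ 2)%:E)%E.
  rewrite -ge0_integralZl //; last 3 first.
  - by apply/measurable_EFinP; apply: measurable_funX; exact: measurable_sqnorm.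
  - by move=> w _; rewrite lee_fin sqr_ge0.
  - by rewrite lee_fin exprn_ge0 // ltW.
  apply: eq_integral => w _; rewrite add0r eucl_normZ; last exact: ltW.
  by rewrite exprMn -EFinM -eucl_norm_sqr -exprM.
rewrite -(fineK f2) -(fineK f4) -EFinM poweR_EFin lee_fin powR_mulrn; last first.
  by apply: Rintegral_ge0 => w _; exact: sqnorm_ge0.
by rewrite -/(Rintegral _ _ _) -ler_pdivlMl // exprn_gt0.
Qed.

End hypercontractive_moments.

Section covariances.
Context (R : realType) d (T : measurableType d) (P : probability T R) (m : nat).
Variable X : T -> 'rV[R]_m.

Lemma centered_Rintegral i : centered P X -> \int[P]_w X w 0 i = 0.
Proof. by move=> /(_ i); rewrite unlock /Rintegral => ->. Qed.

Lemma covmx_Rintegral i j : centered P X ->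
  covmx P X i j = \int[P]_w (X w 0 i * X w 0 j).
Proof.
move=> cX; rewrite mxE covariance.unlock !cX /= expectation.unlock /Rintegral.
congr fine; apply: eq_integral => w _ /=; congr EFin.
by rewrite /GRing.mul /= !subr0.
Qed.

End covariances.

Section independent_sums.
Context (R : realType) d (T : measurableType d) (P : probability T R) (m n : nat).
Variable X : 'I_n -> T -> 'rV[R]_m.
Hypothesis mX : forall j, measurable_fun setT (X j).
Hypothesis indX : mutually_independent P X.

Lemma mutually_independent_family : independent_family P X.
Proof.
move=> B mB; have := indX [set: 'I_n]%SET mB.
rewrite (_ : [set` [set: 'I_n]%SET] = [set: 'I_n]).
  by move=> ->; apply: eq_bigl => i; rewrite inE.
by apply/seteqP; split => i // _ /=; rewrite inE.
Qed.

Hypothesis iX2 : forall j i, intble P (fun w => X j w 0 i * X j w 0 i).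
Hypothesis iX1 : forall j i, intble P (fun w => X j w 0 i).
Hypothesis eX : forall j i, \int[P]_w X j w 0 i = 0.

Let mcoord j i : measurable_fun setT (fun w => X j w 0 i).
Proof. exact: (measurableT_comp (measurable_coord i) (mX j)). Qed.

(** Turns the normalization of the covariance of the sum into one on the summands, where it can be
    transferred to the Gaussian vectors. *)
Lemma variance_independent_sum i :
  \int[P]_w ((\sum_j X j w) 0 i * (\sum_j X j w) 0 i) =
  \sum_j \int[P]_w (X j w 0 i * X j w 0 i).
Proof.
have ind j k : j != k -> independent_pair P (fun w => X j w 0 i) (fun w => X k w 0 i).
  move=> jk; apply: (independent_pair_others mX mutually_independent_family _
    (measurable_coord i)).
  exact: measurable_coord_others.
have iXX j k : intble P (fun w => X j w 0 i * X k w 0 i).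
  have [->|jk] := eqVneq j k; first exact: iX2.
  by apply: independent_pair_integrableM; [exact: mcoord|exact: mcoord|exact: ind
    |exact: iX1|exact: iX1].
have E w : (\sum_j X j w) 0 i * (\sum_j X j w) 0 i =
    \sum_j \sum_k X j w 0 i * X k w 0 i.
  rewrite summxE mulr_suml; apply: eq_bigr => j _; exact: mulr_sumr.
under eq_Rintegral do rewrite E.
rewrite Rintegral_sum; last by move=> j; exact: intble_sum.
apply: eq_bigr => j _; rewrite Rintegral_sum; last exact: iXX.
rewrite (bigD1 j) //= big1 ?addr0 // => k kj; rewrite eq_sym in kj.
rewrite (independent_pair_RintegralM (mcoord j i) (mcoord k i) (ind _ _ kj)) ?eX ?mul0r //.
  exact: iX1.
exact: iX1.
Qed.

End independent_sums.

(** * Gaussian vectors and their sums *)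

Section gaussian_vectors.
Context (R : realType) d (T : measurableType d) (Q : probability T R) (m : nat).
Variable G : T -> 'rV[R]_m.
Hypothesis mG : forall i, measurable_fun setT (fun w => G w 0 i).
Hypotheses (gG : gaussian_vector Q G) (cG : centered Q G).

Lemma gaussian_vector_coord i :
  exists ms : R * R, has_normal_law Q (fun w => G w 0 i) ms.1 ms.2.
Proof.
have [mu [s H]] := gG (delta_mx 0 i); exists (mu, s) => B mB.
rewrite /= -H //; congr (Q _); apply/seteqP; split => w /=;
  rewrite /inner (bigD1 i) //= mxE !eqxx mul1r big1 ?addr0 // => j ji;
  by rewrite mxE (negbTE ji) andbF mul0r.
Qed.

Let icoord i k : intble Q (fun w => G w 0 i ^+ k).
Proof. by have [[mu s] H] := gaussian_vector_coord i; exact: normal_intble H k. Qed.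

Let i4 : intble Q (fun w => m%:R * \sum_i G w 0 i ^+ 4).
Proof. by apply: intbleZ; apply: intble_sum => i; exact: icoord. Qed.

Let sqr_le w : sqnorm (G w) ^+ 2 <= m%:R * \sum_i G w 0 i ^+ 4.
Proof.
apply: (le_trans (sqr_sum_le _)).
by rewrite le_eqVlt; apply/orP; left; apply/eqP; congr (_ * _);
  apply: eq_bigr => i _; rewrite -exprM.
Qed.

Lemma gaussian_vector_intble : intble Q (fun w => sqnorm (G w) ^+ 2).
Proof.
apply: (intble_le _ _ i4); first by apply: measurable_funX; exact: measurable_sqnorm.
by move=> w; rewrite ger0_norm ?sqr_ge0 // sqr_le.
Qed.

(** The coordinates may be arbitrarily correlated, so [sqnorm ^ 2] is first split by Cauchy-Schwarz,
    at the cost of [m]; then the sum of the squared variances is at most the square of their sum. *)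
Lemma gaussian_vector_moment4 :
  \int[Q]_w sqnorm (G w) ^+ 2 <=
    m%:R * (432 * expR (1 / 2)) * (\int[Q]_w sqnorm (G w)) ^+ 2.
Proof.
apply: (le_trans (Rintegral_le gaussian_vector_intble i4 sqr_le)).
rewrite RintegralZl //; last by apply: intble_sum => i; exact: icoord.
rewrite Rintegral_sum; last by move=> i; exact: icoord.
rewrite -mulrA ler_wpM2l //.
have E : \int[Q]_w sqnorm (G w) = \sum_i \int[Q]_w G w 0 i ^+ 2.
  by rewrite Rintegral_sum // => i; exact: icoord.
have v0 i : 0 <= \int[Q]_w G w 0 i ^+ 2.
  by apply: Rintegral_ge0 => w _; exact: sqr_ge0.
have e0 := mulr_ge0 (ler0n R 432) (expR_ge0 (1 / 2 : R)).
apply: (@le_trans _ _ (432 * expR (1 / 2) * \sum_i (\int[Q]_w G w 0 i ^+ 2) ^+ 2)).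
  rewrite mulr_sumr; apply: ler_sum => i _.
  have [[mu s] H] := gaussian_vector_coord i.
  by apply: (normal_moment4_le (mG i) H); exact: centered_Rintegral.
apply: ler_wpM2l => //; rewrite E [leRHS]expr2 mulr_suml; apply: ler_sum => i _.
rewrite expr2; apply: ler_wpM2l => //.
by rewrite (bigD1 i) //= lerDl sumr_ge0.
Qed.

End gaussian_vectors.

Section gaussian_sums.
Context (R : realType) d (T : measurableType d) (Q : probability T R) (m n : nat).
Variable G : 'I_n -> T -> 'rV[R]_m.
Hypothesis mG : forall j, measurable_fun setT (G j).
Hypotheses (gG : forall j, gaussian_vector Q (G j)) (cG : forall j, centered Q (G j)).
Hypothesis indG : mutually_independent Q G.

Let mcoord j i : measurable_fun setT (fun w => G j w 0 i).
Proof. exact: (measurableT_comp (measurable_coord i) (mG j)). Qed.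

(** By [normal_moment2_le], unit total variance forces the parameters [s] to satisfy
    [sum s ^ 2 >= 1 / (4 exp (1 / 2))]. The bump of variance [(5 l) ^ 2] above the plateau then has
    mean at most [5 l] times the square root of [4 exp (1 / 2)]. *)
Lemma gaussian_sum_plateau (l c : R) i : 0 < l ->
  \sum_j \int[Q]_w (G j w 0 i * G j w 0 i) = 1 ->
  \int[Q]_w plateau l c i (\sum_j G j w) <=
    expR (1 / 2) * (5 * l * Num.sqrt (4 * expR (1 / 2))).
Proof.
move=> l0 var1.
have /choice[ms H] : forall j, exists ms : R * R,
    has_normal_law Q (fun w => G j w 0 i) ms.1 ms.2.
  by move=> j; exact: gaussian_vector_coord (gG j) i.
pose s2 := \sum_j (ms j).2 ^+ 2; pose e := 4 * expR (1 / 2 : R).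
have e0 : 0 < e by rewrite mulr_gt0 // expR_gt0.
have s2e : e^-1 <= s2.
  rewrite -[leLHS]mulr1 -var1 ler_pdivrMl // mulr_sumr; apply: ler_sum => j _.
  apply: (normal_moment2_le (mcoord j i) (H j)); exact: centered_Rintegral.
have a0 : 0 < (5 * l) ^+ 2 by rewrite exprn_gt0 // mulr_gt0.
have ind (j : 'I_n) : independent_pair Q (fun w => \sum_(k < n | (k < j)%N) G k w 0 i)
    (fun w => G j w 0 i).
  apply: (independent_pair_others mG (mutually_independent_family indG) _
    (measurable_coord i)).
  under [X in measurable_fun _ X]eq_fun do rewrite big_mkcond.
  apply: measurable_sum => k; case: ltnP => [kj|_]; last exact: measurable_cst.
  by apply: measurable_coord_others; apply: contraTneq kj => ->; rewrite ltnn.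
have := normal_sum_anticoncentration (fun j => mcoord j i) H ind (- c) a0.
pose g (w : T) : R := expR (- (\sum_j G j w 0 i + - c) ^+ 2 / (2 * (5 * l) ^+ 2))%R.
rewrite -/(g _) => bnd.
have mg : measurable_fun setT g.
  apply: measurableT_comp => //; apply: measurable_funM => //.
  apply: measurableT_comp => //; apply: measurable_funX.
  by apply: measurable_funD => //; apply: measurable_sum => j; exact: mcoord.
have ig : intble Q g.
  apply/integrableP; split; first exact/measurable_EFinP.
  under eq_integral do rewrite /= ger0_norm ?expR_ge0 //.
  by apply: (le_lt_trans bnd); rewrite ltry.
have {}bnd : \int[Q]_w g w <= 5 * l * Num.sqrt e.
  apply: (@le_trans _ _ (Num.sqrt ((5 * l) ^+ 2 / ((5 * l) ^+ 2 + s2)))).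
    by rewrite -lee_fin fineK //; exact: integrable_fin_num.
  have l5 : 0 <= 5 * l by rewrite mulr_ge0 // ltW.
  rewrite (_ : 5 * l * Num.sqrt e = Num.sqrt ((5 * l) ^+ 2 * e)); last first.
    by rewrite (sqrtrM _ (sqr_ge0 (5 * l))) sqrtr_sqr ger0_norm.
  apply: ler_wsqrtr; rewrite ler_wpM2l ?sqr_ge0 // invf_ple ?posrE //.
    by apply: (le_trans s2e); rewrite lerDr sqr_ge0.
  by rewrite ltr_wpDr // (le_trans _ s2e) // invr_ge0 ltW.
have [a [b S]] := smooth3_plateau c i l0.
have ib : intble Q (fun w => plateau l c i (\sum_j G j w)).
  apply: (@intble_bounded _ _ _ _ _ 1).
    apply: (taylor_meas S) => k.
    under [X in measurable_fun _ X]eq_fun do rewrite summxE.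
    by apply: measurable_sum => j; exact: mcoord.
  by move=> w; rewrite ger0_norm ?(taylor_ge0 S) ?(taylor_le1 S).
apply: (@le_trans _ _ (\int[Q]_w (expR (1 / 2) * g w))).
  apply: Rintegral_le => //; first exact: intbleZ.
  by move=> w; apply: (le_trans (plateau_le_gauss _ _ _ l0)); rewrite summxE.
by rewrite RintegralZl // ler_wpM2l // expR_ge0.
Qed.

End gaussian_sums.

(** * The two families together *)

Section two_families.
Context (R : realType) (m n : nat).
Local Notation vec := 'rV[R]_m.
Context d (T : measurableType d) (P : probability T R).
Context d' (U : measurableType d') (Q : probability U R).
Variables (X : 'I_n -> T -> vec) (G : 'I_n -> U -> vec).
Hypothesis mX : forall j, measurable_fun setT (X j).
Hypothesis mG : forall j, measurable_fun setT (G j).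
Hypothesis indX : mutually_independent P X.
Hypothesis indG : mutually_independent Q G.

(** The two families live on unrelated probability spaces, while hybrid sums need both on one; the
    product space makes them a single independent family. *)
Definition joined_family (i : bool * 'I_n) (w : T * U) : vec :=
  if i.1 then X i.2 w.1 else G i.2 w.2.

Definition joint_probability : probability (T * U)%type R := (P \x Q)%E.

Lemma joint_probability_fst A : measurable A ->
  joint_probability (fst @^-1` A) = P A.
Proof.
move=> mA; rewrite (_ : fst @^-1` A = A `*` setT); last first.
  by apply/seteqP; split => [[x y]|[x y]] //= [].
by rewrite [LHS]product_measure1E // [X in (_ * X)%E]probability_setT mule1.
Qed.

Lemma joint_probability_snd B : measurable B ->
  joint_probability (snd @^-1` B) = Q B.
Proof.
move=> mB; rewrite (_ : snd @^-1` B = setT `*` B); last first.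
  by apply/seteqP; split => [[x y]|[x y]] //= [].
by rewrite [LHS]product_measure1E // [X in (X * _)%E]probability_setT mul1e.
Qed.

Lemma measurable_joined_family i : measurable_fun setT (joined_family i).
Proof.
case: i => -[] j; rewrite /joined_family /=.
  exact: (measurableT_comp (mX j) measurable_fst).
exact: (measurableT_comp (mG j) measurable_snd).
Qed.

Let mpreX j B : measurable B -> measurable (X j @^-1` B).
Proof. by move=> mB; rewrite -[Y in measurable Y]setTI; exact: mX. Qed.

Let mpreG j B : measurable B -> measurable (G j @^-1` B).
Proof. by move=> mB; rewrite -[Y in measurable Y]setTI; exact: mG. Qed.

Lemma independent_joined_family : independent_family joint_probability joined_family.
Proof.
move=> B mB.
pose C := \bigcap_j (X j @^-1` B (true, j)).
pose D := \bigcap_j (G j @^-1` B (false, j)).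
have mC : measurable C by apply: fin_bigcap_measurable => // j _; exact: mpreX.
have mD : measurable D by apply: fin_bigcap_measurable => // j _; exact: mpreG.
rewrite (_ : \bigcap_i _ = C `*` D); last first.
  apply/seteqP; split => [[x y] h|[x y] [hx hy] [[] j] _]; last 2 first.
  - exact: hx.
  - exact: hy.
  by split => j _; [exact: (h (true, j))|exact: (h (false, j))].
have PC := mutually_independent_family indX (fun j => mB (true, j)).
have QD := mutually_independent_family indG (fun j => mB (false, j)).
rewrite [LHS]product_measure1E // [X in (X * _)%E]PC [X in (_ * X)%E]QD.
rewrite (eq_bigr (fun i =>
  joint_probability (joined_family (i.1, i.2) @^-1` B (i.1, i.2)))); last first.
  by move=> [].
rewrite -(pair_bigA _ (fun b j => joint_probability (joined_family (b, j) @^-1` B (b, j)))) /=.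
rewrite big_bool /=; congr (_ * _)%E; apply: eq_bigr => j _.
  by rewrite -joint_probability_fst //; exact: mpreX.
by rewrite -joint_probability_snd //; exact: mpreG.
Qed.

End two_families.

(** The argument yields [m ^ (3 / 2)], and [3 / 2 <= 13 / 8]. *)
Lemma sqrt_powR_le (R : realType) (m : nat) : (0 < m)%N ->
  Num.sqrt (m%:R : R) ^+ 3 <= m%:R `^ (13 / 8).
Proof.
move=> m0; have m1 : 1 <= m%:R :> R by rewrite ler1n.
rewrite -powR12_sqrt // -powR_mulrn ?powR_ge0 // -powRrM.
by apply: ler_powR => //; lra.
Qed.

(** With the scale [t r], where [r] will be [sqrt d], both terms are multiples of [r ^ 3 t];
    [486 = 9 * 3 ^ 3 * 2]. *)
Lemma optimize_scale (R : realType) (k4 k5 t r L B : R) :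
  0 < t -> 0 < r -> L <= 2 * k4 * r ^+ 6 * t ^+ 4 ->
  B <= r ^+ 2 * (k5 * (t * r)) ->
  9 * (3 / (t * r)) ^+ 3 * L + 2 * B <= (486 * k4 + 2 * k5) * (r ^+ 3 * t).
Proof.
move=> t0 r0 hL hB.
have c0 : 0 <= 9 * (3 / (t * r)) ^+ 3.
  by rewrite mulr_ge0 // exprn_ge0 // divr_ge0 // ltW // mulr_gt0.
apply: (le_trans (lerD (ler_wpM2l c0 hL) (ler_wpM2l (ler0n _ 2) hB))).
rewrite le_eqVlt; apply/orP; left; apply/eqP; field.
by rewrite !gt_eqF.
Qed.

(** * The bound in positive dimension *)

Section clt.
Context (R : realType) (m n : nat) (eta : R).
Local Notation vec := 'rV[R]_m.
Context d (T : measurableType d) (P : probability T R).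
Context d' (U : measurableType d') (Q : probability U R).
Variables (X : 'I_n -> T -> vec) (G : 'I_n -> U -> vec) (A : set vec).
Hypothesis mX : forall j, measurable_fun setT (X j).
Hypothesis mG : forall j, measurable_fun setT (G j).
Hypothesis m0 : (0 < m)%N.
Hypothesis eta01 : 0 < eta < 1.
Hypothesis indX : mutually_independent P X.
Hypothesis hX : forall j, HC P eta (X j).
Hypothesis cX : forall j, centered P (X j).
Hypothesis var1 : forall i, covmx P (fun w => \sum_j X j w) i i = 1.
Hypothesis indG : mutually_independent Q G.
Hypothesis gG : forall j, gaussian_vector Q (G j).
Hypothesis cG : forall j, centered Q (G j).
Hypothesis covG : forall j, covmx Q (G j) = covmx P (X j).
Hypothesis hA : translate_of_union_of_orthants A.

Let eta0 : 0 < eta. Proof. by case/andP: eta01. Qed.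

Let mXc j i : measurable_fun setT (fun w => X j w 0 i).
Proof. exact: (measurableT_comp (measurable_coord i) (mX j)). Qed.

Let mGc j i : measurable_fun setT (fun w => G j w 0 i).
Proof. exact: (measurableT_comp (measurable_coord i) (mG j)). Qed.

Let iX4 j : intble P (fun w => sqnorm (X j w) ^+ 2).
Proof. exact: HC_intble (hX j). Qed.

Let iG4 j : intble Q (fun w => sqnorm (G j w) ^+ 2).
Proof. exact: gaussian_vector_intble. Qed.

Let iXX j a b : intble P (fun w => X j w 0 a * X j w 0 b).
Proof. exact: intble_coordM. Qed.

Let iGG j a b : intble Q (fun w => G j w 0 a * G j w 0 b).
Proof. exact: intble_coordM. Qed.

Let iX1 j a : intble P (fun w => X j w 0 a).
Proof. exact: intble_coord. Qed.

Let iG1 j a : intble Q (fun w => G j w 0 a).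
Proof. exact: intble_coord. Qed.

Let eXX j a b : \int[Q]_w (G j w 0 a * G j w 0 b) = \int[P]_w (X j w 0 a * X j w 0 b).
Proof. by rewrite -!covmx_Rintegral // covG. Qed.

Let centered_sum : centered P (fun w => \sum_j X j w).
Proof.
move=> i; rewrite unlock.
have iS : intble P (fun w => \sum_j X j w 0 i) by apply: intble_sum => j; exact: iX1.
under eq_integral do rewrite summxE.
have f : (\int[P]_w (\sum_j X j w 0 i)%:E)%E \is a fin_num by apply: integrable_fin_num.
rewrite -(fineK f) -/(Rintegral _ _ _) Rintegral_sum //.
by rewrite big1 // => j _; exact: centered_Rintegral.
Qed.

Let unit_variances i : \sum_j \int[P]_w (X j w 0 i * X j w 0 i) = 1.
Proof.
rewrite -(var1 i) covmx_Rintegral // variance_independent_sum //.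
by move=> j a; exact: centered_Rintegral.
Qed.

Let v j := \int[P]_w sqnorm (X j w).

Let v0 j : 0 <= v j.
Proof. by apply: Rintegral_ge0 => w _; exact: sqnorm_ge0. Qed.

Let vE j : v j = \sum_i \int[P]_w (X j w 0 i * X j w 0 i).
Proof.
by rewrite -Rintegral_sum //; apply: eq_Rintegral => w _; apply: eq_bigr.
Qed.

Let vG j : \int[Q]_w sqnorm (G j w) = v j.
Proof.
rewrite vE; transitivity (\sum_i \int[Q]_w (G j w 0 i * G j w 0 i)).
  by rewrite -Rintegral_sum //; apply: eq_Rintegral => w _; apply: eq_bigr.
by apply: eq_bigr => i _; exact: eXX.
Qed.

Let sum_v : \sum_j v j = m%:R.
Proof.
under eq_bigr do rewrite vE; rewrite exchange_big /=.
under eq_bigr do rewrite unit_variances.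
by rewrite sumr_const card_ord.
Qed.

Let k4 : R := 432 * expR (1 / 2).
Let k5 : R := expR (1 / 2) * (5 * Num.sqrt (4 * expR (1 / 2))).

Let k4_ge1 : 1 <= k4.
Proof.
have : 1 <= expR (1 / 2 : R) by rewrite -expR0 ler_expR.
by rewrite /k4; lra.
Qed.

Let t := eta `^ (- (1 / 2)) * (\sum_j v j ^+ 2) `^ (1 / 8).

(** The [v j] add up to [m > 0], so they cannot all vanish. This makes [t], and with it the
    smoothing scale, positive. *)
Let sum_v2 : 0 < \sum_j v j ^+ 2.
Proof.
rewrite lt_neqAle eq_sym sumr_ge0 ?andbT; last by move=> j _; exact: sqr_ge0.
apply/negP => /eqP H; have := sum_v; rewrite big1 => [h|j _].
  by move: m0; rewrite -(ltr0n R) -h ltxx.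
have /eqP := psumr_eq0P (fun j _ => sqr_ge0 (v j)) H (i := j) isT.
by rewrite sqrf_eq0 => /eqP.
Qed.

Let t0 : 0 < t.
Proof. by rewrite mulr_gt0 ?powR_gt0. Qed.

Let t8 : t ^+ 8 = eta ^- 4 * \sum_j v j ^+ 2.
Proof.
rewrite /t exprMn; congr (_ * _).
  rewrite -(powR_mulrn 8 (powR_ge0 _ _)) -powRrM.
  rewrite (_ : - (1 / 2) * 8%:R = - 4%:R :> R); last by field.
  by rewrite powR_invn // ltW.
rewrite -(powR_mulrn 8 (powR_ge0 _ _)) -powRrM.
rewrite (_ : 1 / 8 * 8%:R = 1 :> R); last by field.
by rewrite powRr1 // ltW.
Qed.

Let third_moments :
  \sum_j (\int[P]_w l1norm (X j w) ^+ 3 + \int[Q]_w l1norm (G j w) ^+ 3) <=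
  2 * k4 * m%:R ^+ 3 * t ^+ 4.
Proof.
have hG4 j : \int[Q]_w sqnorm (G j w) ^+ 2 <= m%:R * k4 * v j ^+ 2.
  by rewrite -vG; exact: gaussian_vector_moment4 (mGc j) (gG j) (cG j).
move: (k4) k4_ge1 hG4 => c c1 hG4.
have c0 : 0 <= c by exact: le_trans c1.
(* The AM-GM weight is [a = t ^ -4]. Summed over [j], the second-moment half is [m ^ 2 / (2 a)] and
   the other is [a m ^ 3 c t ^ 8 / 2] by [t8]; both are multiples of [t ^ 4]. *)
have a0 : 0 < t ^- 4 by rewrite invr_gt0 exprn_gt0.
have m1 : 1 <= m%:R :> R by rewrite ler1n.
have e4 : 1 <= eta ^- 4.
  rewrite invf_ge1 ?exprn_gt0 // exprn_ile1 ?ltW //.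
  by case/andP: eta01.
have mc1 : 1 <= m%:R * c by exact: mulr_ege1.
(* One constant for both families: it dominates [eta ^ -4] and [m c], as each of the two is at least
   1. *)
pose K : R := m%:R * c * eta ^- 4.
have hXK j : \int[P]_w sqnorm (X j w) ^+ 2 <= K * v j ^+ 2.
  apply: (le_trans (HC_moment4 (mXc j) eta0 (hX j))).
  apply: ler_wpM2r; first exact: sqr_ge0.
  by apply: ler_peMl => //; exact: le_trans e4.
have hGK j : \int[Q]_w sqnorm (G j w) ^+ 2 <= K * v j ^+ 2.
  apply: (le_trans (hG4 j)); apply: ler_wpM2r; first exact: sqr_ge0.
  by apply: ler_peMr => //; exact: le_trans mc1.
have bX j := l1norm3_le (mXc j) (iX4 j) a0 (erefl (v j)) (hXK j).
have bG j := l1norm3_le (mGc j) (iG4 j) a0 (vG j) (hGK j).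
apply: (le_trans (ler_sum _ (fun j _ => lerD (bX j) (bG j)))).
rewrite big_split /= !big_split /= -!mulr_sumr sum_v.
have E : K * (\sum_j v j ^+ 2) = m%:R * c * t ^+ 8 by rewrite t8 /K mulrA.
rewrite E.
have -> : m%:R / (2 * t ^- 4) * m%:R + t ^- 4 * m%:R ^+ 2 / 2 * (m%:R * c * t ^+ 8) +
  (m%:R / (2 * t ^- 4) * m%:R + t ^- 4 * m%:R ^+ 2 / 2 * (m%:R * c * t ^+ 8)) =
  m%:R ^+ 2 * t ^+ 4 * (1 + m%:R * c).
  by field; rewrite gt_eqF.
have -> : 2 * c * m%:R ^+ 3 * t ^+ 4 = m%:R ^+ 2 * t ^+ 4 * (2 * (m%:R * c)) by ring.
rewrite ler_wpM2l //; first by rewrite mulr_ge0 // exprn_ge0 // ltW.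
by lra.
Qed.

Lemma orthant_clt :
  `| fine (P ((fun w => \sum_j X j w) @^-1` A))
     - fine (Q ((fun w => \sum_j G j w) @^-1` A)) |
  <= (486 * k4 + 2 * k5) * (m%:R `^ (13 / 8) * t).
Proof.
pose r := Num.sqrt (m%:R : R).
have r0 : 0 < r by rewrite sqrtr_gt0 ltr0n.
have r2 : r ^+ 2 = m%:R by rewrite sqr_sqrtr.
have l0 : 0 < t * r by rewrite mulr_gt0.
have [theta [chi [chi01 hchi]]] := orthant_union_indic hA.
have mA := orthant_union_measurable hA.
pose Z := joined_family X G; pose PQ := joint_probability P Q.
have fP B : measurable B -> PQ (fst @^-1` B) = P B by exact: joint_probability_fst.
have sQ B : measurable B -> PQ (snd @^-1` B) = Q B by exact: joint_probability_snd.
have mf : measurable_fun setT (fst : T * U -> T) by exact: measurable_fst.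
have ms : measurable_fun setT (snd : T * U -> U) by exact: measurable_snd.
have tP f : intble P f -> intble PQ (fun w => f w.1).
  exact: (intble_transport mf fP).
have tQ f : intble Q f -> intble PQ (fun w => f w.2).
  exact: (intble_transport ms sQ).
have eP f : intble P f -> \int[PQ]_w f w.1 = \int[P]_w f w.
  exact: (Rintegral_transport mf fP).
have eQ f : intble Q f -> \int[PQ]_w f w.2 = \int[Q]_w f w.
  exact: (Rintegral_transport ms sQ).
have mSX : measurable ((fun w => \sum_j X j w) @^-1` A).
  apply: measurable_preimage_indic; apply: mA => i.
  under [Y in measurable_fun _ Y]eq_fun do rewrite summxE.
  by apply: measurable_sum => j; exact: mXc.
have mSG i : measurable_fun setT (fun w => (\sum_j G j w) 0 i).
  under [Y in measurable_fun _ Y]eq_fun do rewrite summxE.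
  by apply: measurable_sum => j; exact: mGc.
have mSGA : measurable ((fun w => \sum_j G j w) @^-1` A).
  by apply: measurable_preimage_indic; exact: mA.
have iX3 j := intble_l1norm3 (mXc j) (iX4 j).
have iG3 j := intble_l1norm3 (mGc j) (iG4 j).
have main := @orthant_invariance R _ _ PQ m n Z
  (measurable_joined_family mX mG) (independent_joined_family mX mG indX indG).
have {}main := main
  (fun i => match i with (true, j) => fun a => tP _ (iX1 j a)
                       | (false, j) => fun a => tQ _ (iG1 j a) end)
  (fun i => match i with (true, j) => fun a b => tP _ (iXX j a b)
                       | (false, j) => fun a b => tQ _ (iGG j a b) end).
have e1 j a : \int[PQ]_w Z (true, j) w 0 a = \int[PQ]_w Z (false, j) w 0 a.
  by rewrite (eP _ (iX1 j a)) (eQ _ (iG1 j a)) !centered_Rintegral.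
have e2 j a b : \int[PQ]_w (Z (true, j) w 0 a * Z (true, j) w 0 b) =
    \int[PQ]_w (Z (false, j) w 0 a * Z (false, j) w 0 b).
  by rewrite (eP _ (iXX j a b)) (eQ _ (iGG j a b)) eXX.
have {}main := main e1 e2
  (fun i => match i with (true, j) => tP _ (iX3 j) | (false, j) => tQ _ (iG3 j) end).
have {}main := main A theta chi (t * r) l0 mA chi01 hchi.
rewrite -(fP _ mSX) -(sQ _ mSGA); apply: (le_trans main).
apply: (@le_trans _ _ ((486 * k4 + 2 * k5) * (r ^+ 3 * t))); last first.
  apply: ler_wpM2l; last by rewrite ler_wpM2r ?(ltW t0) // sqrt_powR_le.
  apply: addr_ge0; apply: mulr_ge0; rewrite ?ler0n //.
    exact: le_trans ler01 k4_ge1.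
  exact: mulr_ge0 (expR_ge0 _) (mulr_ge0 (ler0n R 5) (sqrtr_ge0 _)).
apply: optimize_scale => //.
  apply: le_trans (_ : _ <= 2 * k4 * m%:R ^+ 3 * t ^+ 4) _; last first.
    by rewrite -r2 -exprM.
  apply: le_trans third_moments; apply: ler_sum => j _.
  by rewrite (eP _ (iX3 j)) (eQ _ (iG3 j)).
rewrite r2 mulr_natl -[X in _ *+ X]card_ord -sumr_const.
apply: ler_sum => i _.
have iB : intble Q (fun w => plateau (t * r) (theta 0 i) i (\sum_j G j w)).
  have [a [b S]] := smooth3_plateau (theta 0 i) i l0.
  apply: (@intble_bounded _ _ _ _ _ 1); first exact: (taylor_meas S).
  by move=> w; rewrite ger0_norm ?(taylor_ge0 S) ?(taylor_le1 S).
rewrite (eQ _ iB); apply: (le_trans (gaussian_sum_plateau mG gG cG indG _ l0 _)).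
  by rewrite -[RHS](unit_variances i); apply: eq_bigr => j _; exact: eXX.
by rewrite /k5 le_eqVlt; apply/orP; left; apply/eqP; ring.
Qed.

End clt.

Theorem theorem4p1 (R : realType) :
  exists2 C : R, 0 < C &
  forall (d n : nat) (eta : R)
    (dT : measure_display) (T : measurableType dT) (P : probability T R)
    (X : 'I_n -> {RV P >-> 'rV[R]_d})
    (dU : measure_display) (U : measurableType dU) (Q : probability U R)
    (G : 'I_n -> {RV Q >-> 'rV[R]_d})
    (A : set 'rV[R]_d),
  let S := fun w : T => \sum_(j < n) X j w in
  let GS := fun u : U => \sum_(j < n) G j u in
  let sigma2 := fun j : 'I_n =>
    fine 'E_P[fun w => (eucl_norm (X j w) ^+ 2)%R]%E in
  0 < eta < 1 ->
  mutually_independent P (fun j => X j) ->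
  (forall j, HC P eta (X j)) ->
  (forall j, centered P (X j)) ->
  (forall i : 'I_d, covmx P S i i = 1) ->
  mutually_independent Q (fun j => G j) ->
  (forall j, gaussian_vector Q (G j)) ->
  (forall j, centered Q (G j)) ->
  (forall j, covmx Q (G j) = covmx P (X j)) ->
  translate_of_union_of_orthants A ->
  `| fine (P (S @^-1` A)) - fine (Q (GS @^-1` A)) |
    <= C * (eta `^ (- (1 / 2)) * d%:R `^ (13 / 8))
         * (\sum_(j < n) sigma2 j ^+ 2) `^ (1 / 8).
Proof.
pose e : R := expR (1 / 2).
exists (486 * (432 * e) + 2 * (e * (5 * Num.sqrt (4 * e)))).
  have p486 : 0 < 486 :> R by rewrite ltr0n.
  have p432 : 0 < 432 :> R by rewrite ltr0n.
  apply: ltr_wpDr; last exact: mulr_gt0 p486 (mulr_gt0 p432 (expR_gt0 _)).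
  exact: mulr_ge0 (ler0n R 2)
    (mulr_ge0 (expR_ge0 _) (mulr_ge0 (ler0n R 5) (sqrtr_ge0 _))).
move=> d n eta dT T P X dU U Q G A S GS sigma2 eta01 indX hX cX var1 indG gG cG covG hA.
have sigma2E j : sigma2 j = \int[P]_w sqnorm (X j w).
  rewrite /sigma2 unlock /Rintegral; congr fine; apply: eq_integral => w _.
  by rewrite eucl_norm_sqr.
under eq_bigr do rewrite sigma2E.
have [d0|d0] := posnP d; last first.
  have mX j : measurable_fun setT (X j) by [].
  have mG j : measurable_fun setT (G j) by [].
  apply: (le_trans (orthant_clt mX mG d0 eta01 indX hX cX var1 indG gG cG covG hA)).
  have reorder (c x y z : R) : c * (x * (y * z)) = c * (y * x) * z by ring.
  by rewrite reorder.
(* In dimension 0 the right-hand side is 0, so the probabilities must coincide. They do: there is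
   only one vector, and both events are full or both are empty. *)
have all_eq (x y : 'rV[R]_d) : x = y.
  by apply/rowP => -[i id]; exfalso; move: id; rewrite d0.
have pre W (V : W -> 'rV[R]_d) : V @^-1` A = if pselect (A 0) then setT else set0.
  case: pselect => A0; apply/seteqP; split => w //=;
    by rewrite (all_eq (V w) 0).
have -> : (d%:R : R) `^ (13 / 8) = 0 by rewrite d0 powR0 // gt_eqF.
rewrite !mulr0 mul0r !pre; case: pselect => A0; last first.
  by rewrite !measure0 subrr normr0.
rewrite (_ : _ - _ = 0) ?normr0 //; apply/eqP; rewrite subr_eq0; apply/eqP.
congr fine; transitivity (1%E : \bar R); first exact: probability_setT.
exact/esym/probability_setT.
Qed.
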